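(* Let $Y$ be an infinite dimensional Banach space such that $\mathcal{K}(\ell_1,Y)$ is an M-ideal in $\mathcal{L}(\ell_1,Y)$. Then every infinite dimensional closed subspace of a quotient $Y/Z$ of $Y$ (where $Z$ is a closed subspace of $Y$) has the local diameter 2 property (LD2P). In particular, every such subspace is not reflexive.
   Context: The scalar field is $\mathbb{K}=\mathbb{R}$ or $\mathbb{C}$. For Banach spaces $X,Y$, $\mathcal{L}(X,Y)$ is the Banach space of bounded linear operators and $\mathcal{K}(X,Y)$ the subspace of compact operators. A closed subspace $J$ of a Banach space $E$ is an L-summand if there is a linear projection $P$ on $E$ with $PE=J$ and $\|x\|=\|Px\|+\|x-Px\|$ for all $x\in E$; $J$ is an M-ideal in $E$ if its annihilator $J^\perp$ is an L-summand in $E^*$. A slice of the closed unit ball $B_W$ of a Banach space $W$ is a set $\{w\in B_W:\operatorname{Re} w^*(w)>1-\delta\}$ with $w^*\in W^*$, $\|w^*\|=1$, and $\delta>0$. $W$ has the LD2P if every slice of $B_W$ has diameter $2$. *)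

(* Defs.v *)
From HB Require Import structures.
From mathcomp Require Import all_boot all_order all_algebra.
From mathcomp Require Import all_classical all_reals all_analysis.
From mathcomp Require Import complex.
Import Order.TTheory GRing.Theory Num.Theory.
Import numFieldNormedType.Exports.
Set Implicit Arguments.
Unset Strict Implicit.
Unset Printing Implicit Defensive.
Local Open Scope classical_set_scope.
Local Open Scope ring_scope.

Inductive scalar_kind := RealScalars | ComplexScalars.

(* Vector spaces are stated over an arbitrary [scalarField R k], which ranges
   over exactly the two fields of real and complex numbers. *)
Definition scalarField (R : realType) (k : scalar_kind) : numFieldType :=
  match k with RealScalars => R | ComplexScalars => R[i]%C end.

Section ScalarField.
Context {R : realType} {k : scalar_kind}.
Local Notation K := (scalarField R k).

Definition re : K -> R :=
  match k return scalarField R k -> R with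
  | RealScalars => id
  | ComplexScalars => @complex.Re R
  end.

Definition ofreal : R -> K :=
  match k return R -> scalarField R k with
  | RealScalars => id
  | ComplexScalars => fun x => (x%:C)%C
  end.

Lemma ofrealK : cancel ofreal re.
Proof. by rewrite /ofreal /re; case: k. Qed.

Lemma reD (x y : K) : re (x + y) = re x + re y.
Proof. by rewrite /re; move: x y; case: k => //= -[a b] [c d]. Qed.

Lemma ofreal0 : ofreal 0 = 0.
Proof. by rewrite /ofreal; case: k => //=; exact: rmorph0. Qed.

Lemma ofrealD x y : ofreal (x + y) = ofreal x + ofreal y.
Proof. by rewrite /ofreal; case: k => //=; exact: rmorphD. Qed.

Lemma ofrealM x y : ofreal (x * y) = ofreal x * ofreal y.
Proof. by rewrite /ofreal; case: k => //=; exact: rmorphM. Qed.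

Lemma ler_ofreal x y : (ofreal x <= ofreal y) = (x <= y).
Proof. by rewrite /ofreal; case: k => //=; exact: lecR. Qed.

Lemma ge0_ofreal (x : K) : 0 <= x -> ofreal (re x) = x.
Proof.
rewrite /ofreal /re; move: x; case: k => //= -[a b].
by rewrite lecE/= => /andP[/eqP -> _].
Qed.

(* The library's norm of a normed module over K takes its values in K. *)
Definition rnorm {V : normedModType K} (x : V) : R := re `|x|.

Section rnorm_theory.
Context {V : normedModType K}.
Implicit Types x y : V.

Lemma ofreal_rnorm x : ofreal (rnorm x) = `|x|.
Proof. by rewrite ge0_ofreal. Qed.

Lemma rnorm_ge0 x : 0 <= rnorm x.
Proof. by rewrite -ler_ofreal ofreal_rnorm ofreal0. Qed.

Lemma ler_rnormD x y : rnorm (x + y) <= rnorm x + rnorm y.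
Proof. by rewrite -ler_ofreal ofrealD !ofreal_rnorm ler_normD. Qed.

Lemma rnorm0 : rnorm (0 : V) = 0.
Proof. by apply: (can_inj ofrealK); rewrite ofreal_rnorm normr0 ofreal0. Qed.

Lemma rnorm0_eq0 x : rnorm x = 0 -> x = 0.
Proof. by move=> x0; apply: normr0_eq0; rewrite -ofreal_rnorm x0 ofreal0. Qed.

End rnorm_theory.

Lemma rnormZ {V : normedModType K} (a : K) (x : V) : rnorm (a *: x) = rnorm (a : K^o) * rnorm x.
Proof. by apply: (can_inj ofrealK); rewrite ofrealM !ofreal_rnorm normrZ. Qed.

Lemma rnorm_gt0 {V : normedModType K} (x : V) : x != 0 -> 0 < rnorm x.
Proof.
move=> x0; rewrite lt_neqAle rnorm_ge0 andbT eq_sym.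
by apply: contra_neq x0 => /rnorm0_eq0.
Qed.

Lemma rnormV (a : K) : a != 0 -> rnorm (a^-1 : K^o) = (rnorm (a : K^o))^-1.
Proof.
move=> a0; have ra0 : rnorm (a : K^o) != 0 by rewrite gt_eqF// rnorm_gt0.
apply: (mulfI ra0); rewrite mulfV//; apply: (can_inj ofrealK).
rewrite ofrealM !ofreal_rnorm -normrM mulfV// normr1.
by rewrite /ofreal; case: (k).
Qed.

Definition unit_ball (V : normedModType K) : set V := [set x | rnorm x <= 1].
Arguments unit_ball : clear implicits.

Definition closed_subspace (V : normedModType K) (J : set V) : Prop :=
  [/\ J 0, (forall x y, J x -> J y -> J (x + y)),
      (forall (a : K) x, J x -> J (a *: x)) & closed J].

Definition finite_dimensional (V : lmodType K) : Prop :=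
  exists n (e : 'I_n -> V), forall v, exists c : 'I_n -> K,
    v = \sum_(i < n) c i *: e i.

Section BoundedOperators.
Variables V W : normedModType K.

Definition bounded_operator : {pred V -> W} := fun f =>
  `[< linear f /\ exists M : R, forall x, rnorm (f x) <= M * rnorm x >].

Record blin := BLin {
  blin_fun :> V -> W ;
  blinP : blin_fun \in bounded_operator }.

HB.instance Definition _ := [isSub for blin_fun].
HB.instance Definition _ := [Choice of blin by <:].

Let bounded_operator_submod : subsemimod_closed bounded_operator.
Proof.
split; first split.
- apply/asboolP; split; first by move=> a x y /=; rewrite scaler0 addr0.
  by exists 0 => x; rewrite mul0r rnorm0.
- move=> f g /asboolP[lf [M fM]] /asboolP[lg [N gN]]; apply/asboolP; split.
    move=> a x y; change (f (a *: x + y) + g (a *: x + y) =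
      a *: (f x + g x) + (f y + g y)).
    by rewrite lf lg scalerDr addrACA.
  exists (M + N) => x; rewrite mulrDl (le_trans (ler_rnormD _ _))//.
  exact: lerD.
- move=> c f /asboolP[lf [M fM]]; apply/asboolP; split.
    move=> a x y; change (c *: f (a *: x + y) = a *: (c *: f x) + c *: f y).
    by rewrite lf scalerDr !scalerA mulrC.
  exists (rnorm (c : K^o) * M) => x.
  by rewrite [X in rnorm X](_ : _ = c *: f x)// rnormZ -mulrA ler_wpM2l// rnorm_ge0.
Qed.

HB.instance Definition _ :=
  GRing.isSubmodClosed.Build K (V -> W) bounded_operator
    bounded_operator_submod.
HB.instance Definition _ := [SubChoice_isSubLmodule of blin by <:].

Definition opnorm (T : blin) : R := sup [set rnorm (T x) | x in unit_ball V].

Lemma blin_linear (T : blin) : linear T.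
Proof. by case: T => f /= /asboolP[]. Qed.

HB.instance Definition _ (T : blin) :=
  GRing.isLinear.Build K V W *:%R T (blin_linear T).

Let opnorm_has_sup (T : blin) : has_sup [set rnorm (T x) | x in unit_ball V].
Proof.
split; first by exists (rnorm (T 0)), 0 => //; rewrite /unit_ball/= rnorm0.
case: T => f /= /asboolP[_ [M fM]]; exists `|M| => _ [x /= x1 <-].
rewrite (le_trans (fM x))// (le_trans (ler_wpM2r (rnorm_ge0 _) (ler_norm M)))//.
by rewrite ler_piMr.
Qed.

Let opnorm_ub (T : blin) x : unit_ball V x -> rnorm (T x) <= opnorm T.
Proof. by move=> x1; apply: (sup_upper_bound (opnorm_has_sup T)); exists x. Qed.

Lemma opnorm_le (T : blin) x : rnorm (T x) <= opnorm T * rnorm x.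
Proof.
have [x0|x0] := eqVneq (rnorm x) 0.
  by rewrite (rnorm0_eq0 x0) linear0 !rnorm0 mulr0.
have xgt0 : 0 < rnorm x by rewrite lt_neqAle eq_sym x0 rnorm_ge0.
have rV : rnorm ((ofreal (rnorm x)^-1 : K) : K^o) = (rnorm x)^-1.
  apply: (can_inj ofrealK); rewrite ofreal_rnorm ger0_norm//.
  by rewrite -ofreal0 ler_ofreal invr_ge0 ltW.
have /(opnorm_ub T) : unit_ball V (ofreal (rnorm x)^-1 *: x).
  by rewrite /unit_ball/= rnormZ rV mulVf.
by rewrite linearZ/= rnormZ rV ler_pdivrMl// mulrC.
Qed.

Let opnorm_lub (T : blin) M : (forall x, unit_ball V x -> rnorm (T x) <= M) ->
  opnorm T <= M.
Proof.
by move=> TM; apply: ge_sup => [|_ [x x1 <-]];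
  [case: (opnorm_has_sup T)|exact: TM].
Qed.

Let opnormD (S T : blin) : opnorm (S + T) <= opnorm S + opnorm T.
Proof.
apply: opnorm_lub => x x1; rewrite (le_trans (ler_rnormD (S x) (T x)))//.
by rewrite lerD// opnorm_ub.
Qed.

Let opnormZ_le (a : K) (T : blin) : opnorm (a *: T) <= rnorm (a : K^o) * opnorm T.
Proof.
apply: opnorm_lub => x x1; rewrite [X in rnorm X](_ : _ = a *: T x)// rnormZ.
by rewrite ler_wpM2l ?rnorm_ge0 ?opnorm_ub.
Qed.

Let opnormZ (a : K) (T : blin) : opnorm (a *: T) = rnorm (a : K^o) * opnorm T.
Proof.
have T0 (S : blin) : 0 <= opnorm S.
  by apply: le_trans (opnorm_ub S (x := 0) _); rewrite ?rnorm_ge0// /unit_ball/= rnorm0.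
apply/eqP; rewrite eq_le opnormZ_le/=; have [->|a0] := eqVneq a 0.
  by rewrite (@rnorm0 K^o) mul0r.
have := opnormZ_le a^-1 (a *: T); rewrite scalerA mulVf// scale1r.
by rewrite rnormV// ler_pdivlMl// rnorm_gt0.
Qed.

Let opnorm0_eq0 (T : blin) : opnorm T = 0 -> T = 0.
Proof.
move=> T0; apply/val_inj/funext => x; apply: rnorm0_eq0; apply/eqP.
by rewrite eq_le rnorm_ge0 andbT (le_trans (opnorm_le T x))// T0 mul0r.
Qed.

HB.instance Definition _ := @Lmodule_isNormed.Build K blin
  (fun T => ofreal (opnorm T))
  (fun S T => etrans (etrans (congr1 _ (esym (ofrealD _ _))) (ler_ofreal _ _))
     (opnormD S T))
  (fun a T => etrans (congr1 ofreal (opnormZ a T))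
     (etrans (ofrealM _ _) (congr1 (fun z => z * _) (@ofreal_rnorm K^o a))))
  (fun T T0 => opnorm0_eq0
     (can_inj ofrealK (etrans T0 (esym ofreal0)))).

Lemma blin_normE (T : blin) : rnorm T = opnorm T.
Proof. exact: ofrealK. Qed.

End BoundedOperators.

Definition dual (V : normedModType K) := blin V K^o.

Definition compact_operators (X Y : normedModType K) : set (blin X Y) :=
  [set T | compact (closure (T @` unit_ball X))].
Arguments compact_operators : clear implicits.

Definition L_summand (E : normedModType K) (J : set E) : Prop :=
  closed_subspace J /\
  exists P : {linear E -> E}, [/\ (forall x, P (P x) = P x), range P = J &
    forall x, rnorm x = rnorm (P x) + rnorm (x - P x)].

Definition annihilator (E : normedModType K) (J : set E) : set (dual E) :=
  [set f | forall x, J x -> f x = 0].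

Definition M_ideal (E : normedModType K) (J : set E) : Prop :=
  closed_subspace J /\ L_summand (annihilator J).

Definition diameter (V : normedModType K) (A : set V) : \bar R :=
  ereal_sup [set (rnorm (p.1 - p.2))%:E | p in A `*` A].

Definition slice (W : normedModType K) (f : dual W) (delta : R) : set W :=
  [set w | unit_ball W w /\ 1 - delta < re (f w)].

Definition LD2P (W : normedModType K) : Prop :=
  forall (f : dual W) (delta : R), rnorm f = 1 -> 0 < delta ->
    diameter (slice f delta) = 2%:E.

(* Surjectivity of the canonical embedding of W into its bidual. *)
Definition reflexive_space (W : normedModType K) : Prop :=
  forall phi : dual (dual W), exists w : W, forall f : dual W, phi f = f w.

Section ell1.

Definition absolutely_summable : {pred nat -> K^o} := fun x =>
  `[< cvgn (series (fun n => rnorm (x n))) >].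

Record ell1 := Ell1 {
  ell1_fun :> nat -> K^o ;
  ell1P : ell1_fun \in absolutely_summable }.

HB.instance Definition _ := [isSub for ell1_fun].
HB.instance Definition _ := [Choice of ell1 by <:].

Let seriesZ (a : R) (u : nat -> R) :
  series (fun n => a * u n) = (fun n => a * series u n).
Proof. by apply/funext => n; rewrite /series/= mulr_sumr. Qed.

Let seriesD (u v : nat -> R) :
  series (fun n => u n + v n) = series u \+ series v.
Proof. by apply/funext => n; rewrite /series/= big_split. Qed.

Let absolutely_summable_submod : subsemimod_closed absolutely_summable.
Proof.
split; first split.
- apply/asboolP; rewrite (_ : series _ = fun=> 0); first exact: is_cvg_cst.
  by apply/funext => n; rewrite /series/= big1// => i _; rewrite rnorm0.
- move=> x y /asboolP cx /asboolP cy; apply/asboolP.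
  apply: (@series_le_cvg _ _ (fun n => rnorm (x n) + rnorm (y n))) => [n|n|n|].
  + exact: rnorm_ge0.
  + by rewrite addr_ge0// rnorm_ge0.
  + exact: ler_rnormD.
  + by rewrite seriesD; exact: is_cvgD.
- move=> a x /asboolP cx; apply/asboolP.
  rewrite (_ : series _ = fun n => rnorm (a : K^o) * series (fun n => rnorm (x n)) n).
    exact: is_cvgMl_tmp.
  rewrite -seriesZ; congr series; apply/funext => n.
  by rewrite [X in rnorm X](_ : _ = a *: x n)// rnormZ.
Qed.

HB.instance Definition _ :=
  GRing.isSubmodClosed.Build K (nat -> K^o) absolutely_summable
    absolutely_summable_submod.
HB.instance Definition _ := [SubChoice_isSubLmodule of ell1 by <:].

Definition ell1_norm (x : ell1) : R := limn (series (fun n => rnorm (x n))).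

Let cvg_ell1 (x : ell1) : cvgn (series (fun n => rnorm (x n))).
Proof. by case: x => x /= /asboolP. Qed.

Let ell1_normD (x y : ell1) : ell1_norm (x + y) <= ell1_norm x + ell1_norm y.
Proof.
rewrite /ell1_norm -limD; [|exact: cvg_ell1..].
apply: ler_lim; [exact: cvg_ell1|by apply: is_cvgD; exact: cvg_ell1|].
apply: nearW => n; rewrite -[leRHS]/((series _ \+ series _) n) -seriesD /series/=.
by apply: ler_sum => i _; exact: ler_rnormD.
Qed.

Let ell1_normZ (a : K) (x : ell1) :
  ell1_norm (a *: x) = rnorm (a : K^o) * ell1_norm x.
Proof.
rewrite [LHS](_ : _ = limn (series (fun n => rnorm (a : K^o) * rnorm (x n)))).
  by rewrite seriesZ; apply: cvg_lim => //; apply: cvgMl_tmp; exact: cvg_ell1.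
congr (limn (series _)); apply/funext => n.
by rewrite [LHS](_ : _ = rnorm (a *: x n))// rnormZ.
Qed.

Let ell1_norm0_eq0 (x : ell1) : ell1_norm x = 0 -> x = 0.
Proof.
move=> x0; apply/val_inj/funext => n; apply: (@rnorm0_eq0 K^o); apply/eqP.
rewrite eq_le rnorm_ge0 andbT -x0.
apply: (@le_trans _ _ (series (fun n => rnorm (x n)) n.+1)).
  by rewrite /series/= big_nat_recr//= lerDr sumr_ge0// => i _; exact: rnorm_ge0.
apply: nondecreasing_cvgn_le; last exact: cvg_ell1.
by apply: nondecreasing_series => i _ _; exact: rnorm_ge0.
Qed.

HB.instance Definition _ := @Lmodule_isNormed.Build K ell1
  (fun x => ofreal (ell1_norm x))
  (fun x y => etrans (etrans (congr1 _ (esym (ofrealD _ _))) (ler_ofreal _ _))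
     (ell1_normD x y))
  (fun a x => etrans (congr1 ofreal (ell1_normZ a x))
     (etrans (ofrealM _ _) (congr1 (fun z => z * _) (@ofreal_rnorm K^o a))))
  (fun x x0 => ell1_norm0_eq0
     (can_inj ofrealK (etrans x0 (esym ofreal0)))).

Lemma ell1_normE (x : ell1) : rnorm x = ell1_norm x.
Proof. exact: ofrealK. Qed.

End ell1.

Record closedSubspace (V : normedModType K) := ClosedSubspace {
  cs_set : set V ;
  cs_closed_subspace : closed_subspace cs_set }.

Section ClosedSubspace.
Variables (V : normedModType K) (J : closedSubspace V).

Definition cs_pred : {pred V} := fun x => `[< cs_set J x >].

Let cs_submod : subsemimod_closed cs_pred.
Proof.
have [J0 JD JZ _] := cs_closed_subspace J; split; first split.
- exact/asboolP.
- by move=> x y /asboolP Ax /asboolP Ay; apply/asboolP; exact: JD.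
- by move=> a x /asboolP Ax; apply/asboolP; exact: JZ.
Qed.

HB.instance Definition _ := GRing.isSubmodClosed.Build K V cs_pred cs_submod.

Record subspaceType := SubspaceType {
  subspace_val :> V ;
  subspace_valP : subspace_val \in cs_pred }.

HB.instance Definition _ := [isSub for subspace_val].
HB.instance Definition _ := [Choice of subspaceType by <:].
HB.instance Definition _ := [SubChoice_isSubLmodule of subspaceType by <:].

Let sub_norm0_eq0 (x : subspaceType) : `|val x| = 0 -> x = 0.
Proof. by move=> /normr0_eq0 x0; apply: val_inj; rewrite x0 raddf0. Qed.

HB.instance Definition _ := @Lmodule_isNormed.Build K subspaceType
  (fun x => `|val x|)
  (fun x y => ler_normD (val x) (val y))
  (fun a x => normrZ a (val x))
  sub_norm0_eq0.

Local Open Scope quotient_scope.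

Definition quotientType := Quotient.quot cs_pred.

HB.instance Definition _ := GRing.Zmodule.on quotientType.
HB.instance Definition _ :
  @EqQuotient V (Quotient.equiv cs_pred) quotientType :=
  EqQuotient.on quotientType.

Definition quotient_proj (v : V) : quotientType := \pi_quotientType v.

Let projD u v : quotient_proj (u + v) = quotient_proj u + quotient_proj v.
Proof. by rewrite /quotient_proj !piE. Qed.

Let proj_eq u v : (quotient_proj u = quotient_proj v) <-> cs_set J (u - v).
Proof.
split=> [/eqP|Juv]; first by rewrite -Quotient.idealrBE => /asboolP.
by apply/eqP; rewrite -Quotient.idealrBE; apply/asboolP.
Qed.

Let projK (q : quotientType) : quotient_proj (repr q) = q.
Proof. exact: reprK. Qed.

Definition quotient_scale (a : K) (q : quotientType) : quotientType :=
  quotient_proj (a *: repr q).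

Let projZ a v : quotient_scale a (quotient_proj v) = quotient_proj (a *: v).
Proof.
apply/proj_eq; rewrite -scalerBr; have [_ _ + _] := cs_closed_subspace J.
by apply; apply/proj_eq; rewrite projK.
Qed.

Let quot_scalerA a b q :
  quotient_scale a (quotient_scale b q) = quotient_scale (a * b) q.
Proof. by rewrite -(projK q) !projZ scalerA. Qed.
Let quot_scale1r : left_id 1 quotient_scale.
Proof. by move=> q; rewrite -(projK q) !projZ scale1r. Qed.
Let quot_scalerDr : right_distributive quotient_scale +%R.
Proof.
move=> a p q; rewrite -(projK p) -(projK q) -projD !projZ -projD.
by rewrite scalerDr.
Qed.
Let quot_scalerDl q : {morph quotient_scale^~ q : a b / a + b}.
Proof. by move=> a b; rewrite -(projK q) !projZ -projD scalerDl. Qed.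

HB.instance Definition _ := GRing.Zmodule_isLmodule.Build K quotientType
  quot_scalerA quot_scale1r quot_scalerDr quot_scalerDl.

(* The distance of v to J, as the infimum of the norms over the coset of v. *)
Definition quotient_norm (q : quotientType) : R :=
  inf [set rnorm v | v in [set v | quotient_proj v = q]].

Let has_inf_quot q :
  has_inf [set rnorm v | v in [set v | quotient_proj v = q]].
Proof.
split; first by exists (rnorm (repr q)), (repr q) => //=; exact: projK.
by exists 0 => _ [v _ <-]; exact: rnorm_ge0.
Qed.

Let quot_norm_le q v : quotient_proj v = q -> quotient_norm q <= rnorm v.
Proof. by move=> vq; apply: ge_inf; [exact: (has_inf_quot q).2|exists v]. Qed.

Let quot_norm_adh q e : 0 < e ->
  exists2 v, quotient_proj v = q & rnorm v < quotient_norm q + e.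
Proof.
by move=> /(inf_adherent)/(_ (has_inf_quot q))[_ [v vq <-] ?]; exists v.
Qed.

Let quot_norm_ge0 q : 0 <= quotient_norm q.
Proof.
apply: lb_le_inf; first exact: (has_inf_quot q).1.
by move=> _ [v _ <-]; exact: rnorm_ge0.
Qed.

Let quot_normD p q :
  quotient_norm (p + q) <= quotient_norm p + quotient_norm q.
Proof.
apply/ler_addgt0Pr => e e0.
have e20 : 0 < e / 2 by rewrite divr_gt0.
have [u up ue] := quot_norm_adh p e20; have [v vq ve] := quot_norm_adh q e20.
apply: (@le_trans _ _ (rnorm (u + v))).
  by apply: quot_norm_le; rewrite projD up vq.
rewrite (le_trans (ler_rnormD u v))//.
by rewrite (splitr e) addrACA lerD// ltW.
Qed.

Let quot_normZ_le a q :
  quotient_norm (a *: q) <= rnorm (a : K^o) * quotient_norm q.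
Proof.
have [->|a0] := eqVneq a 0.
  rewrite (@rnorm0 K^o) mul0r scale0r -(@rnorm0 V).
  by apply: quot_norm_le; rewrite /quotient_proj piE.
have ra0 : 0 < rnorm (a : K^o) by exact: rnorm_gt0.
rewrite -ler_pdivrMl//; apply: lb_le_inf; first exact: (has_inf_quot q).1.
move=> _ [v <- <-]; rewrite ler_pdivrMl// -rnormZ; apply: quot_norm_le.
by rewrite -projZ.
Qed.

Let quot_normZ a q :
  quotient_norm (a *: q) = rnorm (a : K^o) * quotient_norm q.
Proof.
apply/eqP; rewrite eq_le quot_normZ_le/=; have [->|a0] := eqVneq a 0.
  by rewrite (@rnorm0 K^o) mul0r quot_norm_ge0.
have := quot_normZ_le a^-1 (a *: q); rewrite scalerA mulVf// scale1r.
by rewrite rnormV// ler_pdivlMl// rnorm_gt0.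
Qed.

Let quot_norm0_eq0 q : quotient_norm q = 0 -> q = 0.
Proof.
move=> q0; rewrite -(projK q).
have -> : 0 = quotient_proj 0 by rewrite /quotient_proj piE.
apply/proj_eq; rewrite subr0; have [_ _ _ Jcl] := cs_closed_subspace J.
rewrite ((closure_id (cs_set J)).1 Jcl) => B /nbhs_ballP[e /= e0 eB].
have eE : ofreal (re e) = e by rewrite ge0_ofreal// ltW.
have re0 : 0 < re e.
  rewrite lt_neqAle -ler_ofreal eE ofreal0 ltW// andbT.
  by apply: contraTneq e0 => re0; rewrite -eE -re0 ofreal0 ltxx.
have [v vq] := quot_norm_adh q re0; rewrite q0 add0r => ve.
exists (repr q - v); split; first by apply/proj_eq; rewrite projK.
apply: eB; rewrite -ball_normE /= opprB addrC subrK -ofreal_rnorm -eE.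
by rewrite lt_neqAle ler_ofreal (ltW ve) (can_eq ofrealK) lt_eqF.
Qed.

HB.instance Definition _ := @Lmodule_isNormed.Build K quotientType
  (fun q => ofreal (quotient_norm q))
  (fun p q => etrans (etrans (congr1 _ (esym (ofrealD _ _))) (ler_ofreal _ _))
     (quot_normD p q))
  (fun a q => etrans (congr1 ofreal (quot_normZ a q))
     (etrans (ofrealM _ _) (congr1 (fun z => z * _) (@ofreal_rnorm K^o a))))
  (fun q q0 => quot_norm0_eq0
     (can_inj ofrealK (etrans q0 (esym ofreal0)))).

Lemma quotient_normE (q : quotientType) : rnorm q = quotient_norm q.
Proof. exact: ofrealK. Qed.

Lemma subspace_normE (x : subspaceType) : rnorm x = rnorm (subspace_val x).
Proof. by []. Qed.

Lemma quotient_proj_eq u v :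
  (quotient_proj u = quotient_proj v) <-> cs_set J (u - v).
Proof. exact: proj_eq. Qed.

Lemma quotient_proj_linear : linear quotient_proj.
Proof. by move=> a u v; rewrite projD -projZ. Qed.

End ClosedSubspace.

End ScalarField.

Arguments ell1 : clear implicits.
Arguments compact_operators {R k} X Y.

(* Main.v *)
Require Import Defs.
From HB Require Import structures.
From mathcomp Require Import all_boot all_order all_algebra.
From mathcomp Require Import all_classical all_reals all_analysis.
From mathcomp Require Import complex ring lra.
Import Order.TTheory GRing.Theory Num.Theory.
Import numFieldNormedType.Exports.
Set Implicit Arguments.
Unset Strict Implicit.
Unset Printing Implicit Defensive.
Local Open Scope classical_set_scope.
Local Open Scope ring_scope.

(** An M-ideal J of E has the ball property M_ideal_balls: for S in the unit
    ball of E and finitely many x i in that of J, there is one c in J with all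
    S + x i - c of norm at most 1 + e. By Hahn-Banach this is a matter of
    functionals, which the L-projection onto the annihilator of J splits into
    a part testing S and a part testing the x i.

    An operator on l_1 is a bounded sequence y in Y, and a compact one is a
    sequence with relatively compact range. Let S be given by y in the ball
    and let the x i be the constant sequences x and - x. Then c comes close to
    itself at two indices n < m, and averaging the estimates for (n, x) and
    (m, - x) removes c: both x + z and x - z have norm at most 1 + e for
    z = (y n - y m) / 2. This holds for finitely many x at once
    (M_ideal_absorbs_differences) and is inherited by quotients and subspaces,
    so it holds in the space W of the theorem.

    In W, which is infinite dimensional, there is a sequence with mutual
    distances at least 1, so the vectors z can be found with norms bounded
    below. Iterating this yields a copy of c0, and if one starts from a finite
    set for which the norm of z cannot be much larger than is always possible,
    the copy is almost isometric (room_c0_sequence); this short cut stands for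
    James' distortion theorem. An almost isometric copy of c0 contains a
    sequence in the ball with mutual distances almost 2 (c0_two_separated).
    For this sequence z has norm almost 1, so x + z and x - z are almost in the
    ball, are almost 2 apart, and lie in every slice that contains x well
    inside: this is the LD2P (slice_far_points).

    Finally a copy of c0 excludes reflexivity: the partial sums of its basis and
    the functionals norming the basis vectors have iterated limits close to 0
    or to 1, depending on the order of the limits (room_not_reflexive). *)

(** * Real parts and norms over both scalar fields *)

Section Scalars.
Context {R : realType} {k : scalar_kind}.
Local Notation K := (scalarField R k).

Lemma ofreal1 : ofreal 1 = 1 :> K.
Proof. by rewrite /ofreal; case: k. Qed.

Lemma ofrealN (x : R) : ofreal (- x) = - ofreal x :> K.
Proof. by apply/eqP; rewrite -subr_eq0 opprK -ofrealD addNr ofreal0. Qed.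

Lemma re_ofrealM (t : R) (c : K) : re (ofreal t * c) = t * re c.
Proof.
rewrite /ofreal /re; move: c; case: k => //= -[a b] /=.
by rewrite mul0r subr0.
Qed.

Lemma re0 : re (0 : K) = 0.
Proof. by rewrite -ofreal0 ofrealK. Qed.

Lemma reN (c : K) : re (- c) = - re c.
Proof. by apply/eqP; rewrite -subr_eq0 opprK -reD addNr re0. Qed.

Lemma reB (c d : K) : re (c - d) = re c - re d.
Proof. by rewrite reD reN. Qed.

Lemma re_sum (I : Type) (r : seq I) (F : I -> K) :
  re (\sum_(i <- r) F i) = \sum_(i <- r) re (F i).
Proof. by elim/big_rec2: _ => [|i y x _ <-]; rewrite ?re0 ?reD. Qed.

Lemma re_le_rnorm (c : K) : re c <= rnorm (c : K^o).
Proof.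
rewrite /rnorm /re; move: c; case: k => //= [c|[a b] /=]; first exact: ler_norm.
by rewrite (le_trans (ler_norm a))// -sqrtr_sqr ler_sqrt// ?lerDl ?addr_ge0 ?sqr_ge0.
Qed.

Lemma rnorm_ofreal (t : R) : rnorm (ofreal t : K^o) = `|t|.
Proof.
apply: (can_inj (@ofrealK R k)); rewrite ofreal_rnorm.
have [t0|t0] := leP 0 t; first by rewrite !ger0_norm// -ofreal0 ler_ofreal.
by rewrite !ler0_norm ?ofrealN// -?ofreal0 ?ler_ofreal ltW.
Qed.

(** This is how a bound on the real part of a K-linear functional becomes a
    bound on its modulus: the factor u can be moved into the argument. *)
Lemma rotation (c : K) :
  exists2 u : K, rnorm (u : K^o) = 1 & re (u * c) = rnorm (c : K^o).
Proof.
have [->|c0] := eqVneq c 0.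
  exists 1; first by rewrite -ofreal1 rnorm_ofreal normr1.
  by rewrite mulr0 re0 (@rnorm0 _ _ K^o).
exists (`|c| / c); last by rewrite mulfVK.
rewrite -[LHS](ofrealK (k := k)) ofreal_rnorm normrM normfV normr_id mulfV ?normr_eq0//.
by rewrite -ofreal1 ofrealK.
Qed.

End Scalars.

Section NormedFacts.
Context {R : realType} {k : scalar_kind} {V : normedModType (scalarField R k)}.
Local Notation K := (scalarField R k).
Implicit Types x y : V.

Lemma rnormN x : rnorm (- x) = rnorm x.
Proof. by rewrite /rnorm normrN. Qed.

Lemma rnormB x y : rnorm (x - y) = rnorm (y - x).
Proof. by rewrite -rnormN opprB. Qed.

Lemma ler_rnormB x y : rnorm (x - y) <= rnorm x + rnorm y.
Proof. by rewrite -(rnormN y) ler_rnormD. Qed.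

Lemma rnormZr (t : R) x : 0 <= t -> rnorm (ofreal t *: x) = t * rnorm x.
Proof. by move=> t0; rewrite rnormZ rnorm_ofreal ger0_norm. Qed.

End NormedFacts.

(** * The Hahn-Banach theorem for sublinear functionals *)

Section HahnBanach.
Context {R : realType} {k : scalar_kind} {V : lmodType (scalarField R k)}.
Local Notation K := (scalarField R k).
Local Notation "t *:r x" := ((ofreal t : K) *: x) (at level 40).
Implicit Types (p q g : V -> R) (x y : V).

Definition sublinear p : Prop :=
  (forall x y, p (x + y) <= p x + p y) /\
  (forall (t : R) x, 0 < t -> p (t *:r x) <= t * p x).

Definition real_linear g : Prop :=
  (forall x y, g (x + y) = g x + g y) /\
  (forall (t : R) x, g (t *:r x) = t * g x).

Lemma sublinearZ p t x : sublinear p -> 0 < t -> p (t *:r x) = t * p x.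
Proof.
move=> [_ pZ] t0; apply/eqP; rewrite eq_le pZ//= -ler_pdivlMl//.
rewrite -[in leLHS](scale1r x) -ofreal1 -(mulVf (lt0r_neq0 t0)) ofrealM -scalerA.
by rewrite pZ// invr_gt0.
Qed.

Lemma sublinear0 p : sublinear p -> p 0 = 0.
Proof.
move=> sp; have := @sublinearZ p 2 0 sp (ltr0n _ 2).
by rewrite scaler0; lra.
Qed.

Lemma sublinearN p x : sublinear p -> - p (- x) <= p x.
Proof.
move=> sp; rewrite -subr_ge0 opprK -(sublinear0 sp) -(subrr x).
by case: sp.
Qed.

Definition tilt_set p x0 x : set R :=
  [set p (x + t *:r x0) - t * p x0 | t in [set t | 0 <= t]].

(** Lowering p as far as its growth along the ray through x0 permits makes it
    odd on that ray and keeps it sublinear; a minimal sublinear functional is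
    therefore odd everywhere. *)
Definition tilt p x0 x : R := inf (tilt_set p x0 x).

Lemma has_inf_tilt p x0 x : sublinear p -> has_inf (tilt_set p x0 x).
Proof.
move=> sp; split; first by exists (p (x + 0 *:r x0) - 0 * p x0), 0 => /=.
exists (- p (- x)) => _ [t /= t0 <-].
have tp : t * p x0 = p (t *:r x0).
  move: t0; rewrite le_eqVlt => /predU1P[<-|t0]; last by rewrite sublinearZ.
  by rewrite mul0r ofreal0 scale0r sublinear0.
rewrite tp; have := sp.1 (- x) (x + t *:r x0); rewrite addKr.
lra.
Qed.

Lemma tilt_le p x0 x t : sublinear p -> 0 <= t ->
  tilt p x0 x <= p (x + t *:r x0) - t * p x0.
Proof.
by move=> sp t0; apply: ge_inf; [exact: (has_inf_tilt _ _ sp).2|exists t].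
Qed.

Lemma tilt_adherent p x0 x e : sublinear p -> 0 < e ->
  exists2 t, 0 <= t & p (x + t *:r x0) - t * p x0 < tilt p x0 x + e.
Proof.
by move=> sp /inf_adherent/(_ (has_inf_tilt x0 x sp))[_ [t t0 <-] ?]; exists t.
Qed.

Lemma sublinear_tilt p x0 : sublinear p -> sublinear (tilt p x0).
Proof.
move=> sp; split=> [x y|s x s0].
  apply/ler_addgt0Pr => e e0; have e20 : 0 < e / 2 by rewrite divr_gt0.
  have [t t0 te] := tilt_adherent x0 x sp e20.
  have [s s0 se] := tilt_adherent x0 y sp e20.
  have := tilt_le x0 (x + y) sp (addr_ge0 t0 s0).
  have := sp.1 (x + t *:r x0) (y + s *:r x0).
  rewrite addrACA -scalerDl -ofrealD mulrDl.
  lra.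
rewrite -ler_pdivrMl//; apply/ler_addgt0Pr => e e0.
have [t t0 te] := tilt_adherent x0 x sp e0.
have := tilt_le x0 (s *:r x) sp (mulr_ge0 (ltW s0) t0).
rewrite ofrealM -scalerA -scalerDr (sublinearZ _ sp s0) -mulrA -mulrBr => h.
apply: le_trans (ltW te).
by rewrite ler_pdivrMl.
Qed.

Lemma tilt_le_self p x0 x : sublinear p -> tilt p x0 x <= p x.
Proof.
move=> sp; have := tilt_le x0 x sp (lexx 0).
by rewrite ofreal0 scale0r addr0 mul0r subr0.
Qed.

Lemma tiltN p x0 : sublinear p -> tilt p x0 (- x0) <= - p x0.
Proof.
move=> sp; have := tilt_le x0 (- x0) sp ler01.
by rewrite ofreal1 scale1r addNr (sublinear0 sp) mul1r sub0r.
Qed.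

(** Subadditivity at x, y and at x + y, - y gives both inequalities. *)
Lemma odd_sublinear_linear p :
  sublinear p -> (forall x, p (- x) <= - p x) -> real_linear p.
Proof.
move=> sp podd; have pN x : p (- x) = - p x.
  by apply/eqP; rewrite eq_le podd/=; have := sublinearN (- x) sp; rewrite opprK.
split=> [x y|t x].
  apply/eqP; rewrite eq_le sp.1/=.
  have := sp.1 (x + y) (- y); rewrite addrK pN; lra.
have [t0|t0|->] := ltgtP t 0; last 1 first.
- by rewrite ofreal0 scale0r mul0r sublinear0.
- rewrite -[t]opprK ofrealN scaleNr pN sublinearZ ?oppr_gt0//.
  by rewrite !mulNr.
- exact: sublinearZ.
Qed.

(** Zorn's lemma applies since the pointwise infimum of a chain of sublinear
    functionals below p is finite, all of them being at least - p (- x), and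
    sublinear. *)
Lemma minimal_sublinear p : sublinear p ->
  exists q, [/\ sublinear q, (forall x, q x <= p x) &
    forall r, sublinear r -> (forall x, r x <= q x) -> r = q].
Proof.
move=> sp; pose T := {q : V -> R | sublinear q /\ forall x, q x <= p x}.
pose le_T (q r : T) := `[< forall x, sval r x <= sval q x >].
have T_ext (q r : T) : sval q = sval r -> q = r.
  case: q r => [q qP] [r rP] /= qr.
  by case: _ / qr rP => rP; congr exist; exact: Prop_irrelevance.
have [||||q qmin] := @Zorn T le_T.
- by move=> q; apply/asboolP.
- move=> q r s /asboolP qr /asboolP rs; apply/asboolP => x.
  exact: le_trans (rs x) (qr x).
- move=> q r /asboolP qr /asboolP rq; apply: T_ext; apply/funext => x.
  by apply/eqP; rewrite eq_le rq qr.
- move=> A Atot; have [[q0 Aq0]|A0] := pselect (exists q : T, A q); last first.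
    exists (exist _ p (conj sp (fun x => lexx (p x)))) => q Aq.
    by case: A0; exists q.
  pose B x := [set sval (q : T) x | q in A].
  have Binf x : has_inf (B x).
    split; first by exists (sval q0 x), q0.
    exists (- p (- x)) => _ [q Aq <-].
    have [sq qp] := svalP q; rewrite (le_trans _ (sublinearN x sq))//.
    by rewrite lerN2 qp.
  pose m x := inf (B x).
  have mle (q : T) x : A q -> m x <= sval q x.
    by move=> Aq; apply: ge_inf; [exact: (Binf x).2|exists q].
  have madh x e : 0 < e -> exists2 q : T, A q & sval q x < m x + e.
    by move=> /inf_adherent/(_ (Binf x))[_ [q Aq <-] ?]; exists q.
  have sm : sublinear m.
    split=> [x y|t x t0].
      apply/ler_addgt0Pr => e e0; have e20 : 0 < e / 2 by rewrite divr_gt0.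
      have [q Aq qe] := madh x _ e20; have [r Ar rE] := madh y _ e20.
      have [/asboolP qr|/asboolP rq] := Atot q r Aq Ar.
        have := mle r (x + y) Ar; have := (svalP r).1.1 x y; have := qr x; lra.
      have := mle q (x + y) Aq; have := (svalP q).1.1 x y; have := rq y; lra.
    rewrite -ler_pdivrMl//; apply/ler_addgt0Pr => e e0.
    have [q Aq qe] := madh x _ e0.
    rewrite (le_trans _ (ltW qe))// ler_pdivrMl//.
    by rewrite (le_trans (mle _ _ Aq))//; have [[_ ->]] := svalP q.
  have mp x : m x <= p x by rewrite (le_trans (mle q0 x Aq0))//; case: (svalP q0).
  by exists (exist _ m (conj sm mp)) => q Aq; apply/asboolP => x; exact: mle.
have [sq qp] := svalP q; exists (sval q); split=> // r sr rq.
have rp x : r x <= p x := le_trans (rq x) (qp x).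
pose r' : T := exist _ r (conj sr rp).
by rewrite -[r]/(sval r'); congr sval; apply: qmin; apply/asboolP.
Qed.

(** A minimal sublinear functional equals each of its tilts, hence is odd and
    linear. Taking it below the tilt of p along x0 forces the value at - x0
    down to - p x0, and so the value at x0 up to p x0. Working with sublinear
    functionals on the whole space avoids partially defined extensions. *)
Lemma hahn_banach p x0 : sublinear p ->
  exists g, [/\ real_linear g, (forall x, g x <= p x) & g x0 = p x0].
Proof.
move=> sp; have [g [sg gp gmin]] := minimal_sublinear (sublinear_tilt x0 sp).
have gl : real_linear g.
  apply: odd_sublinear_linear => // x.
  rewrite -{1}(gmin _ (sublinear_tilt x sg)) ?tiltN// => y.
  exact: tilt_le_self.
have gp' x : g x <= p x by rewrite (le_trans (gp x))// tilt_le_self.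
exists g; split=> //; apply/eqP; rewrite eq_le gp'/=.
have := gp (- x0); have := tiltN x0 sp; have := sublinearN x0 sg.
lra.
Qed.

End HahnBanach.

(** * Operator norms and functionals *)

Section Operators.
Context {R : realType} {k : scalar_kind}.
Local Notation K := (scalarField R k).
Context {V W : normedModType K}.

Lemma blin_of (f : V -> W) (C : R) :
  linear f -> (forall x, rnorm (f x) <= C * rnorm x) ->
  exists T : blin V W, forall x, T x = f x.
Proof.
move=> lf fC; have fP : f \in @bounded_operator R k V W.
  by apply/asboolP; split=> //; exists C.
by exists (BLin fP).
Qed.

Lemma opnorm_ler (T : blin V W) (C : R) : 0 <= C ->
  (forall x, rnorm (T x) <= C * rnorm x) -> rnorm T <= C.
Proof.
move=> C0 TC; rewrite blin_normE; apply: ge_sup => [|_ [x /= x1 <-]].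
  by exists (rnorm (T 0)), 0 => //; rewrite /unit_ball/= rnorm0.
by rewrite (le_trans (TC x))// ler_piMr.
Qed.

Lemma ler_opnorm (T : blin V W) x : rnorm (T x) <= rnorm T * rnorm x.
Proof. by rewrite blin_normE; exact: opnorm_le. Qed.

Lemma ler_opnorm1 (T : blin V W) x : rnorm x <= 1 -> rnorm (T x) <= rnorm T.
Proof.
by move=> x1; rewrite (le_trans (ler_opnorm T x))// ler_piMr// rnorm_ge0.
Qed.

Lemma opnorm_adherent (T : blin V W) (e : R) : 0 < e ->
  exists2 x, rnorm x <= 1 & rnorm T - e < rnorm (T x).
Proof.
move=> e0; rewrite blin_normE.
have [|_ [x /= x1 <-] xe] :=
    @sup_adherent _ [set rnorm (T x) | x in @unit_ball R k V] e e0.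
  split; first by exists (rnorm (T 0)), 0 => //; rewrite /unit_ball/= rnorm0.
  by exists (rnorm T) => _ [x /= x1 <-]; exact: ler_opnorm1.
by exists x.
Qed.

Lemma blinD (S T : blin V W) x : (S + T) x = S x + T x.
Proof. by []. Qed.

Lemma blinN (T : blin V W) x : (- T) x = - T x.
Proof. by []. Qed.

Lemma blinZ (a : K) (T : blin V W) x : (a *: T) x = a *: T x.
Proof. by []. Qed.

Lemma blinB (S T : blin V W) x : (S - T) x = S x - T x.
Proof. by []. Qed.

End Operators.

Section Dual.
Context {R : realType} {k : scalar_kind}.
Local Notation K := (scalarField R k).
Context {V : normedModType K}.
Implicit Types (f : dual V) (x : V).

Lemma re_dual_le f x : re (f x) <= rnorm f * rnorm x.
Proof. exact: le_trans (re_le_rnorm _) (ler_opnorm f x). Qed.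

Lemma dual_norm_ler f (C : R) : 0 <= C ->
  (forall x, re (f x) <= C * rnorm x) -> rnorm f <= C.
Proof.
move=> C0 fC; apply: opnorm_ler => // x.
have [u u1 <-] := rotation (f x).
have -> : u * f x = f (u *: x) by rewrite linearZ.
by rewrite (le_trans (fC _))// rnormZ u1 mul1r.
Qed.

Lemma dual_norm_adherent f (e : R) : 0 < e ->
  exists2 x, rnorm x <= 1 & rnorm f - e < re (f x).
Proof.
move=> /(opnorm_adherent f)[x x1 xe]; have [u u1 ux] := rotation (f x).
exists (u *: x); first by rewrite rnormZ u1 mul1r.
by rewrite linearZ/= ux.
Qed.

Lemma real_linear_re f : real_linear (fun x => re (f x)).
Proof.
split=> [x y|t x]; first by rewrite linearD reD.
by rewrite linearZ/= re_ofrealM.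
Qed.

End Dual.

(** A real functional g is the real part of the K-linear functional
    x |-> g x - i g (i x), and rotations show that the norms agree. *)
Lemma dual_of_real (R : realType) (k : scalar_kind)
    (V : normedModType (scalarField R k)) (g : V -> R) (C : R) :
  real_linear g -> (forall x, g x <= C * rnorm x) -> 0 <= C ->
  exists2 f : dual V, (forall x, re (f x) = g x) & rnorm f <= C.
Proof.
move=> [gD gZ] gC C0.
suff [f lf fg] : exists2 f : V -> (scalarField R k)^o, linear f &
    forall x, re (f x) = g x.
  have [x|F FE] := @blin_of _ _ _ _ f C lf.
    have [u u1 <-] := rotation (f x : scalarField R k).
    have -> : u * f x = f (u *: x).
      have := lf u x 0; rewrite addr0 => ->.
      have := lf 1 0 0; rewrite scaler0 addr0 scale1r => /eqP.
      by rewrite -subr_eq subrr eq_sym => /eqP ->; rewrite addr0.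
    by rewrite fg (le_trans (gC _))// rnormZ u1 mul1r.
  have FgE x : re (F x) = g x by rewrite FE.
  by exists F => //; apply: dual_norm_ler => // x; rewrite FgE.
have gN x : g (- x) = - g x.
  by have := gZ (-1) x; rewrite ofrealN ofreal1 scaleN1r mulN1r.
case: k => [|] in V g gD gZ gC gN *.
  by exists g => // a x y; rewrite gD gZ.
pose i : R[i]%C := ('i)%C.
have ii x : i *: (i *: x) = - x.
  by rewrite scalerA -expr2 sqr_i scaleN1r.
exists (fun x => (g x -i* g (i *: x))%C) => //.
move=> a x y; case: a => a b.
have -> : (a +i* b)%C = ((a%:C)%C + (b%:C)%C * i :> R[i]%C).
  by apply/eqP; rewrite eq_complex/=; apply/andP; split; apply/eqP; ring.
have gE z : g (((a%:C)%C + (b%:C)%C * i) *: x + z) = a * g x + b * g (i *: x) + g z.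
  by rewrite gD scalerDl gD -scalerA !gZ.
have giE z : g (i *: (((a%:C)%C + (b%:C)%C * i) *: x + z)) =
    a * g (i *: x) - b * g x + g (i *: z).
  rewrite scalerDr scalerA mulrC -scalerA gD scalerDl gD -scalerA ii.
  by rewrite !gZ gN mulrN.
rewrite gE giE; apply/eqP; rewrite eq_complex/=.
by apply/andP; split; apply/eqP; rewrite /GRing.scale/=; ring.
Qed.

Lemma norming_functional (R : realType) (k : scalar_kind)
    (V : normedModType (scalarField R k)) (x : V) :
  exists2 f : dual V, rnorm f <= 1 & re (f x) = rnorm x.
Proof.
have sn : sublinear (@rnorm R k V).
  by split=> [? ?|t y t0]; [exact: ler_rnormD|rewrite rnormZr// ltW].
have [g [gl gn gx]] := hahn_banach x sn.
have [||f fg f1] := @dual_of_real _ _ V g 1 gl => //.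
  by move=> y; rewrite mul1r.
by exists f; rewrite ?fg.
Qed.

(** A substitute for weak-star compactness of the dual ball: the upper limit of
    the h j is sublinear, and a linear functional below it obeys every upper
    bound that the h j obey eventually. Applied to - x, it obeys the eventual
    lower bounds too. *)
Lemma cluster_functional (R : realType) (k : scalar_kind)
    (V : normedModType (scalarField R k)) (h : nat -> V -> R) :
  (forall j, real_linear (h j)) -> (forall j x, h j x <= rnorm x) ->
  exists f : dual V, forall x c,
    (exists N, forall j, (N <= j)%N -> h j x <= c) -> re (f x) <= c.
Proof.
move=> hl h1; pose ev x := [set c | exists N, forall j, (N <= j)%N -> h j x <= c].
have hN j x : - rnorm x <= h j x.
  have [_ hZ] := hl j; have := h1 j (- x); have := hZ (-1) x.
  by rewrite ofrealN ofreal1 scaleN1r mulN1r rnormN => ->; rewrite lerNl.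
have evinf x : has_inf (ev x).
  split; first by exists (rnorm x), 0%N.
  by exists (- rnorm x) => c [N /(_ _ (leqnn N))]; exact: le_trans.
pose p x := inf (ev x).
have ple x c : ev x c -> p x <= c by move=> ?; apply: ge_inf => //; case: (evinf x).
have padh x e : 0 < e -> exists2 c, ev x c & c < p x + e.
  by move=> /inf_adherent/(_ (evinf x))[c ? ?]; exists c.
have sp : sublinear p.
  split=> [x y|t x t0].
    apply/ler_addgt0Pr => e e0; have e20 : 0 < e / 2 by rewrite divr_gt0.
    have [c [N cN] ce] := padh x _ e20; have [d [M dM] de] := padh y _ e20.
    have : p (x + y) <= c + d.
      apply: ple; exists (maxn N M) => j; rewrite geq_max => /andP[Nj Mj].
      by have [-> _] := hl j; rewrite lerD ?cN ?dM.
    lra.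
  rewrite -ler_pdivrMl//; apply/ler_addgt0Pr => e e0.
  have [c [N cN] ce] := padh x _ e0; apply: le_trans (ltW ce).
  rewrite ler_pdivrMl//; apply: ple; exists N => j Nj.
  by have [_ ->] := hl j; rewrite ler_pM2l// cN.
have [g [gl gp _]] := hahn_banach 0 sp.
have [||f fg _] := @dual_of_real _ _ V g 1 gl => //.
  by move=> x; rewrite mul1r (le_trans (gp x))//; apply: ple; exists 0%N.
by exists f => x c xc; rewrite fg (le_trans (gp x))//; apply: ple.
Qed.

(** * The ball property of M-ideals *)

Lemma real_linear_sum (R : realType) (k : scalar_kind)
    (V : lmodType (scalarField R k)) (g : V -> R) (I : Type) (r : seq I)
    (F : I -> V) :
  real_linear g -> g (\sum_(i <- r) F i) = \sum_(i <- r) g (F i).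
Proof.
move=> [gD gZ]; elim/big_rec2: _ => [|i y x _ <-]; last by rewrite gD.
by have := gZ 0 0; rewrite scaler0 mul0r.
Qed.

Lemma blin_sum (R : realType) (k : scalar_kind)
    (V W : normedModType (scalarField R k)) (I : Type) (r : seq I)
    (F : I -> blin V W) x :
  (\sum_(i <- r) F i) x = \sum_(i <- r) F i x.
Proof. by elim/big_rec2: _ => [|i y T _ <-]. Qed.

Section MIdealBalls.
Context {R : realType} {k : scalar_kind}.
Local Notation K := (scalarField R k).
Context {E : normedModType K} {J : set E} {N : nat}.
Hypothesis Jsub : closed_subspace J.
Implicit Types v : 'I_N -> E.

Definition radii v : set R :=
  [set M | 0 <= M /\ exists2 c, J c & forall i, rnorm (v i - c) <= M].

(** The distance of v to the diagonal copy of J in the sup norm of E^N. *)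
Definition diagonal_distance v : R := inf (radii v).

Lemma has_inf_radii v : has_inf (radii v).
Proof.
have [J0 _ _ _] := Jsub; split; last by exists 0 => M [].
exists (\sum_i rnorm (v i)); split; first by apply: sumr_ge0 => i _; exact: rnorm_ge0.
exists 0 => // i; rewrite subr0 (bigD1 i)//= lerDl.
by apply: sumr_ge0 => j _; exact: rnorm_ge0.
Qed.

Lemma diagonal_distance_le v M c : 0 <= M -> J c ->
  (forall i, rnorm (v i - c) <= M) -> diagonal_distance v <= M.
Proof.
move=> M0 Jc vc; apply: ge_inf; first exact: (has_inf_radii v).2.
by split=> //; exists c.
Qed.

Lemma diagonal_distance_adherent v e : 0 < e ->
  exists M c, [/\ 0 <= M, M < diagonal_distance v + e, J c &
    forall i, rnorm (v i - c) <= M].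
Proof.
by move=> /inf_adherent/(_ (has_inf_radii v))[M [M0 [c Jc vc]] ?]; exists M, c.
Qed.

Lemma sublinear_diagonal_distance : sublinear diagonal_distance.
Proof.
have [_ JD JZ _] := Jsub; split=> [v w|t v t0].
  apply/ler_addgt0Pr => e e0; have e20 : 0 < e / 2 by rewrite divr_gt0.
  have [M [c [M0 Me Jc vc]]] := diagonal_distance_adherent v e20.
  have [L [d [L0 Le Jd wd]]] := diagonal_distance_adherent w e20.
  have : diagonal_distance (v + w) <= M + L.
    apply: (@diagonal_distance_le _ _ (c + d)); [exact: addr_ge0|exact: JD|].
    move=> i; rewrite (_ : (v + w) i - _ = (v i - c) + (w i - d)).
      by rewrite (le_trans (ler_rnormD _ _))// lerD.
    by rewrite [(v + w) i]/(v i + w i) opprD addrACA.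
  lra.
rewrite -ler_pdivrMl//; apply/ler_addgt0Pr => e e0.
have [M [c [M0 Me Jc vc]]] := diagonal_distance_adherent v e0.
apply: le_trans (ltW Me); rewrite ler_pdivrMl//.
apply: (@diagonal_distance_le _ _ (ofreal t *: c)).
- by rewrite mulr_ge0// ltW.
- exact: JZ.
- move=> i; rewrite [(_ *: v) i]/(ofreal t *: v i) -scalerBr rnormZr ?(ltW t0)//.
  by rewrite ler_pM2l.
Qed.

(** A linear functional on E^N below the diagonal distance and equal to it at v
    has coordinates phi i. It vanishes on the diagonal of J, where the distance
    is zero, and the norms of the phi i sum up to at most one because the
    distance is at most the sup norm. *)
Lemma diagonal_separation v :
  exists phi : 'I_N -> dual E,
    [/\ diagonal_distance v = \sum_i re (phi i (v i)),
        annihilator J (\sum_i phi i) & \sum_i rnorm (phi i) <= 1].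
Proof.
have [J0 _ JZ _] := Jsub.
have [g [gl gp gv]] := hahn_banach v sublinear_diagonal_distance.
pose inj (i : 'I_N) (x : E) : 'I_N -> E := fun j => if j == i then x else 0.
have inj_rl i : real_linear (fun x => g (inj i x)).
  have [gD gZ] := gl; split=> [x y|t x].
    rewrite -gD; congr g; apply/funext => j; rewrite /inj.
    change ((if j == i then x + y else 0) =
      (if j == i then x else 0) + (if j == i then y else 0)).
    by case: eqP => //; rewrite addr0.
  rewrite -gZ; congr g; apply/funext => j; rewrite /inj.
  by change ((if j == i then ofreal t *: x else 0) =
    ofreal t *: (if j == i then x else 0)); case: eqP => //; rewrite scaler0.
have inj_le i x : g (inj i x) <= 1 * rnorm x.
  rewrite mul1r (le_trans (gp _))//; apply: (@diagonal_distance_le _ _ 0) => //.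
    exact: rnorm_ge0.
  by move=> j; rewrite subr0 /inj; case: eqP => // _; rewrite rnorm0 rnorm_ge0.
have [phi phiE] : exists phi : 'I_N -> dual E,
    forall i x, re (phi i x) = g (inj i x).
  have h i : {f : dual E | forall x, re (f x) = g (inj i x)}.
    by apply: cid; have [//|f ? _] := dual_of_real (inj_rl i) (inj_le i); exists f.
  by exists (fun i => sval (h i)) => i; exact: svalP (h i).
have gE w : g w = \sum_i re (phi i (w i)).
  have -> : w = \sum_i inj i (w i).
    apply/funext => j; rewrite fct_sumE (bigD1 j)//= /inj eqxx big1 ?addr0// => i.
    by rewrite eq_sym => /negbTE ->.
  rewrite real_linear_sum//; apply: eq_bigr => i _; rewrite phiE; congr (g (inj i _)).
  rewrite fct_sumE (bigD1 i)//= /inj eqxx big1 ?addr0// => j.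
  by rewrite eq_sym => /negbTE ->.
have diag0 c : J c -> re ((\sum_i phi i) c) <= 0.
  move=> Jc; rewrite blin_sum re_sum -(gE (fun=> c)) (le_trans (gp _))//.
  by apply: (@diagonal_distance_le _ _ c) => // i; rewrite subrr rnorm0.
exists phi; split; first by rewrite -gv gE.
  move=> c Jc; apply: (@rnorm0_eq0 _ _ K^o); apply/eqP; rewrite eq_le rnorm_ge0 andbT.
  have [u _ <-] := rotation ((\sum_i phi i) c : K).
  have -> : (u * (\sum_i phi i) c : K) = (\sum_i phi i) (u *: c) by rewrite linearZ.
  exact/diag0/JZ.
apply/ler_addgt0Pr => e e0.
(* N.+1 in place of N covers the empty family. *)
have d0 : 0 < e / N.+1%:R by rewrite divr_gt0.
have h i : {x | rnorm x <= 1 & rnorm (phi i) - e / N.+1%:R < re (phi i x)}.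
  by apply: cid2; exact: dual_norm_adherent.
pose x i := s2val (h i).
have : g x <= 1.
  rewrite (le_trans (gp _))//; apply: (@diagonal_distance_le _ _ 0) => // i.
  by rewrite subr0; exact: (s2valP (h i)).
have : \sum_i (rnorm (phi i) - e / N.+1%:R) <= g x.
  by rewrite gE ler_sum// => i _; exact: ltW (s2valP' (h i)).
rewrite sumrB sumr_const card_ord -(mulr_natr (e / _)) => le1 le2.
have : e / N.+1%:R * N%:R <= e.
  by rewrite -mulrA ler_piMr ?(ltW e0)// mulrC ler_pdivrMr// mul1r ler_nat.
set a := e / _ * _ in le1 *; set b := \sum_i _ in le1 *.
lra.
Qed.

End MIdealBalls.

(** Let phi compute the diagonal distance of (S + x i)_i, and let P be the
    L-projection onto the annihilator of J. The sum of the phi i is fixed by P,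
    so the parts psi i = phi i - P (phi i) have sum zero. Hence S is tested by
    the P (phi i) only, and x i, lying in J, by psi i only. The distance is at
    most the sum of the norms of all these parts, which is the sum of the norms
    of the phi i. *)
Lemma M_ideal_balls (R : realType) (k : scalar_kind)
    (E : normedModType (scalarField R k)) (J : set E) (N : nat)
    (S : E) (x : 'I_N -> E) (e : R) :
  M_ideal J -> rnorm S <= 1 -> (forall i, J (x i)) ->
  (forall i, rnorm (x i) <= 1) -> 0 < e ->
  exists2 c, J c & forall i, rnorm (S + x i - c) <= 1 + e.
Proof.
move=> [Jsub [_ [P [PP PJ PL]]]] S1 Jx x1 e0.
pose v i := S + x i; have v0 : diagonal_distance (J := J) v <= 1.
  have [phi [-> phiJ phi1]] := diagonal_separation Jsub v.
  apply: le_trans phi1.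
  have PJ0 f c : J c -> P f c = 0.
    by have /(_ c) : annihilator J (P f) by rewrite -PJ; exists f.
  have Psum : P (\sum_i phi i) = \sum_i phi i.
    by move: phiJ; rewrite -PJ => -[f _ <-]; rewrite PP.
  have psi0 : \sum_i re ((phi i - P (phi i)) S) = 0.
    by rewrite -re_sum -blin_sum sumrB -linear_sum Psum subrr re0.
  rewrite -[leLHS]subr0 -[X in _ - X]psi0 -sumrB ler_sum// => i _.
  have psiE z : (phi i - P (phi i)) z = phi i z - P (phi i) z by [].
  rewrite PL psiE /v linearD reB reD.
  have := re_dual_le (P (phi i)) S; have := re_dual_le (phi i - P (phi i)) (x i).
  rewrite psiE PJ0// subr0.
  have := ler_piMr (rnorm_ge0 (P (phi i))) S1.
  have := ler_piMr (rnorm_ge0 (phi i - P (phi i))) (x1 i).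
  lra.
have [M [c [_ Me Jc vc]]] := diagonal_distance_adherent Jsub v e0.
by exists c => // i; rewrite (le_trans (vc i))//; lra.
Qed.

(** * Operators on the space of summable sequences *)

Section ScalarsOrder.
Context {R : realType} {k : scalar_kind}.
Local Notation K := (scalarField R k).

Lemma ltr_ofreal (x y : R) : (ofreal x < ofreal y :> K) = (x < y).
Proof. by rewrite !lt_neqAle ler_ofreal (can_eq (@ofrealK R k)). Qed.

Lemma gt0_ofreal (e : K) : 0 < e -> ofreal (re e) = e /\ 0 < re e.
Proof.
move=> e0; have eE : ofreal (re e) = e by rewrite ge0_ofreal// ltW.
by split=> //; rewrite -ltr_ofreal ofreal0 eE.
Qed.

Lemma ball_rnorm (V : normedModType K) (x : V) (e : R) :
  ball x (ofreal e : K) = [set y | rnorm (x - y) < e].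
Proof.
rewrite -ball_normE; apply/seteqP; split=> y /=;
  by rewrite -ofreal_rnorm ltr_ofreal.
Qed.

Lemma nbhs_rnormP (V : normedModType K) (x : V) (A : set V) :
  nbhs x A <-> exists2 e : R, 0 < e & forall y, rnorm (x - y) < e -> A y.
Proof.
split=> [/nbhs_ballP[e /= /gt0_ofreal[eE e0]]|[e e0 eA]].
  by rewrite -eE ball_rnorm => eA; exists (re e) => // y; exact: eA.
apply/nbhs_ballP; exists (ofreal e : K) => /=; first by rewrite -ofreal0 ltr_ofreal.
by rewrite ball_rnorm.
Qed.

End ScalarsOrder.

Section NormLimits.
Context {R : realType} {k : scalar_kind}.
Local Notation K := (scalarField R k).

(** Convergence is expressed with the real-valued norm, so that real and
    complex scalars can be treated alike. *)
Definition norm_limit {V : normedModType K} (u : nat -> V) (l : V) : Prop :=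
  forall e : R, 0 < e -> exists N, forall n, (N <= n)%N -> rnorm (u n - l) <= e.

Lemma norm_limit_unique (V : normedModType K) (u : nat -> V) l l' :
  norm_limit u l -> norm_limit u l' -> l = l'.
Proof.
move=> ul ul'; apply/eqP; rewrite -subr_eq0; apply/eqP/rnorm0_eq0/eqP.
rewrite eq_le rnorm_ge0 andbT; apply/ler_addgt0Pr => e e0; rewrite add0r.
have e20 : 0 < e / 2 by rewrite divr_gt0.
have [N uN] := ul _ e20; have [M uM] := ul' _ e20.
have := uN _ (leq_maxl N M); have := uM _ (leq_maxr N M).
rewrite (rnormB _ l); move: (u _) => x xl' xl.
rewrite -(subrK x l) -addrA (le_trans (ler_rnormD _ _))//.
by rewrite (splitr e) lerD.
Qed.

Lemma norm_limit_lin (V : normedModType K) (u v : nat -> V) l l' (a : K) :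
  norm_limit u l -> norm_limit v l' ->
  norm_limit (fun n => a *: u n + v n) (a *: l + l').
Proof.
move=> ul vl e e0; have a0 : 0 < rnorm (a : K^o) + 1 by rewrite ltr_wpDl// rnorm_ge0.
have e20 : 0 < e / 2 by rewrite divr_gt0.
have [N uN] := ul _ (divr_gt0 e20 a0); have [M vM] := vl _ e20.
exists (maxn N M) => n; rewrite geq_max => /andP[/uN un /vM vn].
rewrite opprD addrACA -scalerBr (le_trans (ler_rnormD _ _))// rnormZ.
rewrite (splitr e) lerD//; move: un; rewrite ler_pdivlMr//; apply: le_trans.
by rewrite mulrC ler_wpM2l ?rnorm_ge0// lerDl.
Qed.

Lemma norm_limit_le (V : normedModType K) (u : nat -> V) l (C : R) :
  norm_limit u l -> (forall n, rnorm (u n) <= C) -> rnorm l <= C.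
Proof.
move=> ul uC; apply/ler_addgt0Pr => e /ul[N /(_ _ (leqnn N)) h].
rewrite -(subKr (u N) l) (le_trans (ler_rnormB _ _))//.
by rewrite lerD.
Qed.

Lemma norm_limit_closed (V : normedModType K) (u : nat -> V) l (A : set V) :
  closed A -> norm_limit u l -> (forall n, A (u n)) -> A l.
Proof.
move=> Acl ul uA; apply: Acl => B /nbhs_rnormP[e e0 eB].
have [N /(_ _ (leqnn N)) uN] := ul _ (divr_gt0 e0 (ltr0n _ 2)).
exists (u N); split=> //; apply: eB; rewrite rnormB (le_lt_trans uN)//.
by rewrite ltr_pdivrMr// ltr_pMr// ltr1n.
Qed.

Lemma norm_cauchy_limit (V : completeNormedModType K) (u : nat -> V) :
  (forall e : R, 0 < e -> exists N, forall n, (N <= n)%N -> rnorm (u N - u n) < e) ->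
  exists l, norm_limit u l.
Proof.
move=> ucauchy; have ucvg : cvg (u @ \oo).
  apply/cauchy_cvgP/cauchy_exP => e /= /gt0_ofreal[eE /ucauchy[N uN]].
  by exists (u N), N => // n /= Nn; rewrite -eE ball_rnorm; exact: uN.
exists (lim (u @ \oo)) => e e0.
have e0' : 0 < (ofreal e : K) by rewrite -ofreal0 ltr_ofreal.
have /cvgrPdist_le/(_ _ e0')[N _ uN] : u @ \oo --> lim (u @ \oo) by [].
by exists N => n Nn; have /= := uN n Nn; rewrite -ofreal_rnorm ler_ofreal rnormB.
Qed.

End NormLimits.

Section Ell1Operators.
Context {R : realType} {k : scalar_kind}.
Local Notation K := (scalarField R k).
Implicit Types a b : ell1 R k.

Lemma ell1_partial_le a n : \sum_(0 <= i < n) rnorm (a i) <= rnorm a.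
Proof.
rewrite ell1_normE; apply: (@nondecreasing_cvgn_le _ (series (fun i => rnorm (a i)))).
  by apply: nondecreasing_series => i _ _; exact: rnorm_ge0.
by have /asboolP := ell1P a.
Qed.

Lemma ell1_norm_ler a (C : R) :
  (forall n, \sum_(0 <= i < n) rnorm (a i) <= C) -> rnorm a <= C.
Proof.
move=> aC; rewrite ell1_normE; apply: limr_le; last exact: nearW.
by have /asboolP := ell1P a.
Qed.

Lemma ell1_tail a (e : R) : 0 < e -> exists N, forall n, (N <= n)%N ->
  \sum_(N <= i < n) rnorm (a i) < e.
Proof.
move=> e0; have /asboolP acvg := ell1P a.
have /cvgrPdist_lt/(_ e e0)[N _ aN] :
  series (fun i => rnorm (a i)) @ \oo --> rnorm a by rewrite ell1_normE.
exists N => n Nn; have /= := aN N (leqnn N); rewrite ger0_norm; last first.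
  by rewrite subr_ge0; exact: ell1_partial_le.
apply: le_lt_trans; rewrite lerBrDr addrC.
by rewrite -(@big_cat_nat _ _ _ N)//; exact: ell1_partial_le.
Qed.

Lemma ell1_unit_ex n : exists2 e : ell1 R k, rnorm e <= 1 &
  forall i, e i = (i == n)%:R.
Proof.
pose d i : K^o := (i == n)%:R.
have dsum m : \sum_(0 <= i < m) rnorm (d i) <= 1.
  have dE i : rnorm (d i) = (i == n)%:R.
    rewrite /d; case: eqP => _; rewrite ?rnorm0//.
    by rewrite -[1 in LHS]ofreal1 rnorm_ofreal normr1.
  under eq_bigr do rewrite dE.
  rewrite -natr_sum (ler_nat _ _ 1%N); have [nm|mn] := ltnP n m.
    rewrite (@bigD1_seq _ _ _ _ _ n) ?mem_index_iota ?iota_uniq//= eqxx big1// => i.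
    by move=> /negbTE ->.
  rewrite big_nat big1// => i /andP[_ im].
  by case: eqP => // ein; move: im; rewrite ein ltnNge mn.
have dP : d \in @absolutely_summable R k.
  apply/asboolP; apply: nondecreasing_is_cvgn.
    by apply: nondecreasing_series => i _ _; exact: rnorm_ge0.
  by exists 1 => _ [m _ <-]; exact: dsum.
by exists (Ell1 dP) => //; exact: ell1_norm_ler.
Qed.

Definition ell1_unit n : ell1 R k := s2val (cid2 (ell1_unit_ex n)).

Lemma ell1_unit_norm n : rnorm (ell1_unit n) <= 1.
Proof. exact: s2valP (cid2 (ell1_unit_ex n)). Qed.

Lemma ell1_unitE n i : ell1_unit n i = (i == n)%:R.
Proof. exact: (s2valP' (cid2 (ell1_unit_ex n))). Qed.

Definition partial_combination (Y : normedModType K) (y : nat -> Y) a n :=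
  \sum_(0 <= i < n) a i *: y i.

Lemma rnorm_sum_le (Y : normedModType K) (m n : nat) (u : nat -> Y) :
  rnorm (\sum_(m <= i < n) u i) <= \sum_(m <= i < n) rnorm (u i).
Proof.
elim/big_rec2: _ => [|i s t _ h]; first by rewrite rnorm0.
by rewrite (le_trans (ler_rnormD _ _))// lerD2l.
Qed.

Lemma block_combination_le (Y : normedModType K) (y : nat -> Y) a m n :
  (forall i, rnorm (y i) <= 1) ->
  rnorm (\sum_(m <= i < n) a i *: y i) <= \sum_(m <= i < n) rnorm (a i).
Proof.
move=> y1; rewrite (le_trans (rnorm_sum_le _ _ _))// ler_sum// => i _.
by rewrite rnormZ ler_piMr// rnorm_ge0.
Qed.

(** The series of the a i *: y i converges absolutely. Its partial sums are
    recorded as well, since they locate the values of the operator. *)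
Lemma ell1_operator (Y : completeNormedModType K) (y : nat -> Y) :
  (forall n, rnorm (y n) <= 1) ->
  exists T : blin (ell1 R k) Y, [/\ rnorm T <= 1,
    forall n, T (ell1_unit n) = y n &
    forall a, norm_limit (partial_combination y a) (T a)].
Proof.
move=> y1; have lim_ex a : {l | norm_limit (partial_combination y a) l}.
  apply: cid; apply: norm_cauchy_limit => e /(ell1_tail a)[N aN].
  exists N => n Nn; rewrite rnormB /partial_combination (@big_cat_nat _ _ _ N)//=.
  rewrite addrAC subrr add0r (le_lt_trans _ (aN n Nn))//; exact: block_combination_le.
pose f a := sval (lim_ex a); have fP a := svalP (lim_ex a).
have flin : linear f.
  move=> c a b; apply: norm_limit_unique (fP _) _.
  have := norm_limit_lin c (fP a) (fP b); congr norm_limit; apply/funext => n.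
  rewrite /partial_combination scaler_sumr -big_split; apply: eq_bigr => i _ /=.
  by rewrite scalerA -scalerDl.
have f1 a : rnorm (f a) <= 1 * rnorm a.
  rewrite mul1r; apply: norm_limit_le (fP a) _ => n.
  rewrite (le_trans (block_combination_le _ _ _ y1))//; exact: ell1_partial_le.
have [T TE] := blin_of flin f1; exists T; split.
- by apply: opnorm_ler => // a; rewrite TE.
- move=> n; rewrite TE; apply: norm_limit_unique (fP _) _ => e e0.
  exists n.+1 => m nm; rewrite /partial_combination.
  rewrite (@bigD1_seq _ _ _ _ _ n) ?mem_index_iota ?iota_uniq//= ell1_unitE eqxx scale1r.
  rewrite big1 ?addr0 ?subrr ?rnorm0 ?(ltW e0)// => i.
  by rewrite ell1_unitE => /negbTE ->; rewrite scale0r.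
- by move=> a; rewrite TE; exact: fP.
Qed.

(** It lets compactness of the scalar disc be read off from that of a real
    square; for real scalars i is 0. *)
Lemma scalar_coordinates : exists i : K, forall c : K, rnorm (c : K^o) <= 1 ->
  exists s t : R, [/\ `|s| <= 1, `|t| <= 1 & c = ofreal s + ofreal t * i].
Proof.
rewrite /ofreal /rnorm /re; case: k => [|] /=.
  by exists 0 => c c1; exists c, 0; rewrite mulr0 addr0 normr0.
exists ('i)%C => -[s t] /= c1; exists s, t; split.
- apply: le_trans c1; rewrite -sqrtr_sqr ler_sqrt// ?lerDl ?addr_ge0 ?sqr_ge0//.
- apply: le_trans c1; rewrite -sqrtr_sqr ler_sqrt// ?lerDr ?addr_ge0 ?sqr_ge0//.
- by apply/eqP; rewrite eq_complex/=; apply/andP; split; apply/eqP; ring.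
Qed.

Lemma compact_square (Y : normedModType K) (x x' : Y) :
  compact ((fun p : R * R => ofreal p.1 *: x + ofreal p.2 *: x') @`
           (`[-1, 1] `*` `[-1, 1])).
Proof.
have scont (z : Y) : continuous (fun t : R => (ofreal t : K) *: z).
  move=> t A /nbhs_rnormP[e e0 eA].
  have z0 : 0 < rnorm z + 1 by rewrite ltr_wpDl// rnorm_ge0.
  exists (e / (rnorm z + 1)) => /=; first exact: divr_gt0.
  move=> s /=; rewrite ltr_pdivlMr// => ts; apply: eA.
  rewrite -scalerBl -ofrealN -ofrealD rnormZ rnorm_ofreal (le_lt_trans _ ts)//.
  by rewrite ler_wpM2l// lerDl.
apply: continuous_compact; last by apply: compact_setX; exact: segment_compact.
apply: continuous_subspaceT => p.
apply: cvgD.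
  by apply: (@continuous_comp _ _ _ fst (fun t : R => (ofreal t : K) *: x));
    [exact: cvg_fst|exact: scont].
by apply: (@continuous_comp _ _ _ snd (fun t : R => (ofreal t : K) *: x'));
  [exact: cvg_snd|exact: scont].
Qed.

(** The unit ball is mapped into the multiples of x by scalars of the disc, a
    subset of the compact parallelogram spanned by x and i *: x. *)
Lemma compact_constant_operator (Y : normedModType K) (x : Y)
    (T : blin (ell1 R k) Y) :
  (forall a, norm_limit (partial_combination (fun=> x) a) (T a)) ->
  compact_operators (ell1 R k) Y T.
Proof.
move=> TP; have [i iP] := scalar_coordinates.
have Dcompact := @compact_square _ x (i *: x); set D := _ @` _ in Dcompact.
have Dcl : closed D by apply: compact_closed => //; exact: norm_hausdorff.
have TD a : rnorm a <= 1 -> D (T a).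
  move=> a1; apply: norm_limit_closed Dcl (TP a) _ => n.
  have [|s [t [s1 t1 stE]]] := iP (\sum_(0 <= j < n) a j).
    by rewrite (le_trans (rnorm_sum_le _ _ _))// (le_trans (ell1_partial_le a n)).
  exists (s, t).
    by split => /=; rewrite in_itv/= -ler_norml.
  by rewrite /partial_combination -scaler_suml stE scalerDl -scalerA.
apply: subclosed_compact Dcompact _; first exact: closed_closure.
rewrite ((closure_id D).1 Dcl); apply: closure_subset => _ [a /= a1 <-].
exact: TD.
Qed.

End Ell1Operators.

(** * Absorbing differences of bounded sequences *)

Section AbsorbingDifferences.
Context {R : realType} {k : scalar_kind}.
Local Notation K := (scalarField R k).

(** The trace that the ball property of the ideal leaves on the space itself. No
    correcting term is left in it, which is why it passes to subspaces. *)
Definition absorbs_differences (V : normedModType K) : Prop :=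
  forall (y : nat -> V) (F : seq V) (e : R),
    (forall n, rnorm (y n) <= 1) -> {in F, forall x, rnorm x <= 1} -> 0 < e ->
  exists n m, (n < m)%N /\ {in F, forall x,
    rnorm (x + ofreal 2^-1 *: (y n - y m)) <= 1 + e /\
    rnorm (x - ofreal 2^-1 *: (y n - y m)) <= 1 + e}.

Lemma compact_close_pair (V : normedModType K) (C : set V) (u : nat -> V) (e : R) :
  compact C -> (forall n, C (u n)) -> 0 < e ->
  exists n m, (n < m)%N /\ rnorm (u n - u m) <= e.
Proof.
move=> Cco uC e0; have e20 : 0 < e / 2 by rewrite divr_gt0.
have [|p [_ up]] := Cco (u @ \oo) _; first by exists 0%N => // n _; exact: uC.
have close N : exists2 n, (N <= n)%N & rnorm (p - u n) < e / 2.
  have [] := up (u @` [set n | (N <= n)%N]) [set z | rnorm (p - z) < e / 2].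
  - by exists N => // n Nn; exists n.
  - by apply/nbhs_rnormP; exists (e / 2).
  - by move=> _ [[n Nn <-] nz]; exists n.
have [n _ np] := close 0%N; have [m nm mp] := close n.+1.
exists n, m; split=> //; rewrite -(subrK p (u n)) -addrA.
by rewrite (le_trans (ler_rnormD _ _))// (splitr e) lerD ?(ltW mp)// rnormB ltW.
Qed.

Lemma half_double (V : lmodType K) (x : V) : ofreal 2^-1 *: (x + x) = x.
Proof.
rewrite -[in x + x](scale1r x) -ofreal1 -scalerDl -ofrealD scalerA -ofrealM.
by rewrite mulVf ?ofreal1 ?scale1r// pnatr_eq0.
Qed.

(** The operator mapping the unit vectors to the y n and the rank one
    operators mapping all of them to +x or -x are put into the ball property
    of the ideal. The compact correction c nearly agrees at two unit vectors;
    in the half difference of the estimates for (y n, x) and (y m, -x) it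
    cancels out. *)
Lemma M_ideal_absorbs_differences (Y : completeNormedModType K) :
  M_ideal (compact_operators (ell1 R k) Y) -> absorbs_differences Y.
Proof.
move=> MI y F e y1 F1 e0; pose G := F ++ map -%R F.
have G1 x : x \in G -> rnorm x <= 1.
  by rewrite mem_cat => /orP[/F1//|/mapP[z /F1 z1 ->]]; rewrite rnormN.
have [S [S1 SE _]] := ell1_operator y1.
have [T TP] : exists T : 'I_(size G) -> blin (ell1 R k) Y, forall i,
    [/\ rnorm (T i) <= 1, forall n, T i (ell1_unit n) = G`_i &
        compact_operators (ell1 R k) Y (T i)].
  have h (i : 'I_(size G)) : {T : blin (ell1 R k) Y | [/\ rnorm T <= 1,
      forall n, T (ell1_unit n) = G`_i & compact_operators (ell1 R k) Y T]}.
    apply: cid; have [_|T [T1 TE Tlim]] := @ell1_operator _ _ Y (fun=> G`_i).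
      by apply: G1; rewrite mem_nth.
    by exists T; split=> //; exact: compact_constant_operator Tlim.
  by exists (fun i => sval (h i)) => i; exact: svalP (h i).
have e20 : 0 < e / 2 by rewrite divr_gt0.
have [|i|c cJ cP] := M_ideal_balls (x := T) MI S1 _ _ e20.
- by move=> i; have [] := TP i.
- by have [] := TP i.
have Gy n x : x \in G -> rnorm (y n + x - c (ell1_unit n)) <= 1 + e / 2.
  move=> xG; have ix : (index x G < size G)%N by rewrite index_mem.
  have := le_trans (ler_opnorm1 _ (ell1_unit_norm n)) (cP (Ordinal ix)).
  have [_ TE _] := TP (Ordinal ix).
  by rewrite blinB blinD SE TE /= nth_index.
have [n [m [nm cnm]]] : exists n m, (n < m)%N /\
    rnorm (c (ell1_unit n) - c (ell1_unit m)) <= e.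
  apply: compact_close_pair cJ _ e0 => n; apply: subset_closure.
  by exists (ell1_unit n) => //; exact: ell1_unit_norm.
exists n, m; split=> // x xF.
have xG : x \in G by rewrite mem_cat xF.
have NxG : - x \in G by rewrite mem_cat map_f ?orbT.
have half p q : rnorm (c (ell1_unit p) - c (ell1_unit q)) <= e ->
    rnorm (x + ofreal 2^-1 *: (y p - y q)) <= 1 + e.
  move=> cpq; set cp := c _ in cpq *; set cq := c _ in cpq *.
  have -> : x + ofreal 2^-1 *: (y p - y q) = ofreal 2^-1 *:
      ((y p + x - cp) - (y q - x - cq) + (cp - cq)).
    rewrite -[in LHS](half_double x) -scalerDr; congr (_ *: _).
    rewrite (opprD (y q - x)) (addrACA (y p + x)) -opprD addrNK.
    by rewrite opprD opprK [RHS]addrACA addrC.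
  rewrite rnormZr ?invr_ge0// ler_pdivrMl//.
  have := Gy p _ xG; have := Gy q _ NxG; rewrite -/cp -/cq => hq hp.
  have := ler_rnormD (y p + x - cp - (y q - x - cq)) (cp - cq).
  have := ler_rnormB (y p + x - cp) (y q - x - cq).
  lra.
split; first exact: half.
by rewrite -scalerN opprB; apply: half; rewrite rnormB.
Qed.

(** Points of the unit ball lift to the ball of radius 1 + d. Scaling by 1 + d
    before and after the use of the property in V costs a factor of
    (1 + d) ^+ 2, which is at most 1 + 3 * d if d is at most 1. *)
Lemma quotient_map_absorbs_differences (V Q : normedModType K) (pi : {linear V -> Q}) :
  (forall v, rnorm (pi v) <= rnorm v) ->
  (forall q e, 0 < e -> exists2 v, pi v = q & rnorm v < rnorm q + e) ->
  absorbs_differences V -> absorbs_differences Q.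
Proof.
move=> pi1 pi_lift VA y F e y1 F1 e0.
pose d := Num.min 1 (e / 3); have d0 : 0 < d by rewrite lt_min ltr01 divr_gt0.
have d10 : 0 < 1 + d by rewrite addr_gt0.
have lift_ex q : {v | pi v = q & rnorm v < rnorm q + d} by apply/cid2/pi_lift.
pose l q := ofreal (1 + d)^-1 *: s2val (lift_ex q).
have lE q : pi (ofreal (1 + d) *: l q) = q.
  by rewrite scalerA -ofrealM mulfV ?gt_eqF// ofreal1 scale1r (s2valP (lift_ex q)).
have l1 q : rnorm q <= 1 -> rnorm (l q) <= 1.
  move=> q1; rewrite rnormZr ?invr_ge0 ?(ltW d10)// ler_pdivrMl// mulr1.
  by rewrite (le_trans (ltW (s2valP' (lift_ex q))))// lerD2r.
have [n [m [nm lnm]]] : exists n m, (n < m)%N /\ {in map l F, forall x,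
    rnorm (x + ofreal 2^-1 *: (l (y n) - l (y m))) <= 1 + d /\
    rnorm (x - ofreal 2^-1 *: (l (y n) - l (y m))) <= 1 + d}.
  by apply: (VA (l \o y)) => // [n|_ /mapP[x xF ->]]; apply: l1;
    [exact: y1|exact: F1].
exists n, m; split=> // x xF.
have push (t : K) : rnorm (l x + t *: (l (y n) - l (y m))) <= 1 + d ->
    rnorm (x + t *: (y n - y m)) <= 1 + e.
  move=> h; have -> : x + t *: (y n - y m) =
      pi (ofreal (1 + d) *: (l x + t *: (l (y n) - l (y m)))).
    rewrite [in RHS]scalerDr scalerA mulrC -scalerA [ofreal _ *: (_ - _)]scalerBr.
    rewrite [RHS]linearD [X in _ = X + _]lE; congr (_ + _).
    by rewrite [RHS]linearZ [pi _]linearB !lE.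
  rewrite (le_trans (pi1 _))//.
  rewrite rnormZr ?(ltW d10)// (le_trans (ler_wpM2l (ltW d10) h))//.
  have d1 : d <= 1 by rewrite ge_min lexx.
  have de : d <= e / 3 by rewrite ge_min lexx orbT.
  have := ler_piMr (ltW d0) d1; lra.
have [h1 h2] := lnm _ (map_f l xF); split; first exact: push.
by rewrite -scaleNr; apply: push; rewrite scaleNr.
Qed.

Lemma isometry_absorbs_differences (V W : normedModType K) (i : {linear W -> V}) :
  (forall w, rnorm (i w) = rnorm w) ->
  absorbs_differences V -> absorbs_differences W.
Proof.
move=> iI VA y F e y1 F1 e0.
have [n [m [nm h]]] : exists n m, (n < m)%N /\ {in map i F, forall x,
    rnorm (x + ofreal 2^-1 *: (i (y n) - i (y m))) <= 1 + e /\
    rnorm (x - ofreal 2^-1 *: (i (y n) - i (y m))) <= 1 + e}.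
  by apply: (VA (i \o y)) => // [n|_ /mapP[x xF ->]] /=; rewrite iI;
    [exact: y1|exact: F1].
exists n, m; split=> // x xF; have := h _ (map_f i xF).
by rewrite -linearB -linearZ -linearD -linearB !iI.
Qed.

Lemma quotient_absorbs_differences (V : normedModType K) (Z : closedSubspace V) :
  absorbs_differences V -> absorbs_differences (quotientType Z).
Proof.
pose pi := GRing.isLinear.Build K V (quotientType Z) *:%R
  (@quotient_proj R k V Z) (@quotient_proj_linear R k V Z).
pose piL : {linear V -> quotientType Z} := HB.pack (@quotient_proj R k V Z) pi.
have lift (q : quotientType Z) : has_inf [set rnorm v | v in [set v | piL v = q]].
  split; last by exists 0 => _ [v _ <-]; exact: rnorm_ge0.
  by exists (rnorm (repr q)), (repr q) => //=; exact: reprK.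
apply: (@quotient_map_absorbs_differences _ _ piL) => [v|q e].
  by rewrite quotient_normE; apply: ge_inf; [exact: (lift _).2|exists v].
move=> /inf_adherent/(_ (lift q))[_ [v vq <-] ve].
by exists v => //; rewrite quotient_normE.
Qed.

Lemma subspace_absorbs_differences (V : normedModType K) (W : closedSubspace V) :
  absorbs_differences V -> absorbs_differences (subspaceType W).
Proof.
exact: (@isometry_absorbs_differences _ _ (\val : {linear subspaceType W -> V})).
Qed.

End AbsorbingDifferences.

(** * Separated sequences in infinite dimensional spaces *)

Lemma greedy_sequence (T : Type) (P : seq T -> T -> Prop) :
  (forall l, exists x, P l x) ->
  exists (y : nat -> T) (L : nat -> seq T),
    [/\ L 0%N = [::], forall n, L n.+1 = y n :: L n & forall n, P (L n) (y n)].
Proof.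
move=> Pex; have step l : {x | P l x} by exact: cid.
pose L n := iter n (fun l => sval (step l) :: l) [::].
by exists (fun n => sval (step (L n))), L; split=> // n; exact: svalP (step (L n)).
Qed.

Section InfiniteDimension.
Context {R : realType} {k : scalar_kind}.
Local Notation K := (scalarField R k).
Context {V : normedModType K}.

(** A functional that does not vanish on the kernels of the others contributes
    one more vector e i, on which it is normalised. *)
Lemma finite_codimension (fs : seq (dual V)) : exists n (e : 'I_n -> V),
  forall v, exists c : 'I_n -> K, exists2 u : V,
    {in fs, forall f : dual V, f u = 0} & v = \sum_i c i *: e i + u.
Proof.
elim: fs => [|f fs [n [e eP]]].
  exists 0%N, (fun=> 0) => v; exists (fun=> 0), v => //.
  by rewrite big_ord0 add0r.
have [[v0 fsv0 fv0]|fs0] := pselect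
    (exists2 v0, {in fs, forall g : dual V, g v0 = 0} & f v0 != 0).
  exists n.+1, (fun i => oapp e v0 (unlift ord0 i)) => v.
  have [c [u fsu ->]] := eP v; pose t : K := f u / f v0.
  exists (fun i => oapp c t (unlift ord0 i)), (u - t *: v0).
    move=> g; rewrite inE => /predU1P[->|gfs].
      rewrite linearB linearZ /= /t /GRing.scale/= mulfVK// subrr//.
    by rewrite linearB linearZ/= fsu// fsv0// scaler0 subr0.
  rewrite big_ord_recl unlift_none /= [t *: v0 + _]addrC -addrA.
  rewrite [t *: v0 + _]addrC subrK; congr (_ + _).
  by apply: eq_bigr => i _; rewrite liftK.
exists n, e => v; have [c [u fsu ->]] := eP v; exists c, u => // g.
rewrite inE => /predU1P[->|]; last exact: fsu.
by apply/eqP/negPn/negP => fu; apply: fs0; exists u.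
Qed.

Hypothesis V_infinite : ~ finite_dimensional V.

Lemma common_kernel (fs : seq (dual V)) :
  exists2 u : V, rnorm u = 1 & {in fs, forall f : dual V, f u = 0}.
Proof.
have [n [e eP]] := finite_codimension fs.
have [u u0 fsu] : exists2 u, u != 0 & {in fs, forall f : dual V, f u = 0}.
  apply: contrapT => no; apply: V_infinite; exists n, e => v.
  have [c [u fsu vE]] := eP v; exists c; rewrite vE.
  have [->|u0] := eqVneq u 0; first by rewrite addr0.
  by case: no; exists u.
have ru : 0 < rnorm u by exact: rnorm_gt0.
exists (ofreal (rnorm u)^-1 *: u).
  by rewrite rnormZr ?invr_ge0 ?ltW// mulVf ?gt_eqF.
by move=> f fin; rewrite linearZ/= fsu// scaler0.
Qed.

(** Each new vector is chosen in the kernels of norming functionals of the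
    earlier ones. This replaces Riesz' lemma and spares the closedness of
    finite dimensional subspaces. *)
Lemma separated_sequence : exists y : nat -> V,
  (forall n, rnorm (y n) = 1) /\ forall n m, (n < m)%N -> 1 <= rnorm (y n - y m).
Proof.
have nf (x : V) : {f : dual V | rnorm f <= 1 & re (f x) = rnorm x}.
  exact/cid2/norming_functional.
pose f x := s2val (nf x).
have [y [L [L0 LS yP]]] := @greedy_sequence V
  (fun l u => rnorm u = 1 /\ {in map f l, forall g : dual V, g u = 0})
  (fun l => let: ex_intro2 u u1 fu := common_kernel (map f l) in
    ex_intro _ u (conj u1 fu)).
exists y; split=> [n|n m nm]; first by have [] := yP n.
have [_ /(_ (f (y n)))] := yP m.
have yL : y n \in L m.
  elim: m nm => // m IH; rewrite ltnS leq_eqVlt LS inE => /predU1P[->|/IH ->].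
    by rewrite eqxx.
  by rewrite orbT.
move=> /(_ (map_f f yL)) fnm; have [yn1 _] := yP n.
have := re_dual_le (f (y n)) (y n - y m).
rewrite linearB/= fnm subr0 (s2valP' (nf (y n))) yn1 => h.
by rewrite (le_trans h)// ler_piMl ?rnorm_ge0// (s2valP (nf (y n))).
Qed.

End InfiniteDimension.

(** * Almost isometric copies of c0 *)

Section AlmostIsometricC0.
Context {R : realType} {k : scalar_kind}.
Local Notation K := (scalarField R k).
Context {V : normedModType K}.
Implicit Types (z : nat -> V) (F : seq V).

Definition in_open_ball F : Prop := {in F, forall x, rnorm x < 1}.

Definition fits F (z : V) : Prop :=
  {in F, forall x, rnorm (x + z) < 1 /\ rnorm (x - z) < 1}.

(** Finite subsets of the open ball stay away from the sphere, which absorbs all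
    the small errors; no error term has to be carried through an iteration. *)
Definition room (c : R) : Prop :=
  forall F, in_open_ball F -> exists2 z, fits F z & c < rnorm z.

Lemma in_smaller_ball F : in_open_ball F ->
  exists2 r, 2^-1 <= r < 1 & {in F, forall x, rnorm x <= r}.
Proof.
elim: F => [|x F IH] F1.
  by exists 2^-1 => //; rewrite lexx invf_lt1 ?ltr0n// ltr1n.
have [y yF|r /andP[r2 r1] Fr] := IH; first by apply: F1; rewrite inE yF orbT.
exists (Num.max r (rnorm x)).
  by rewrite le_max r2 gt_max r1 F1// mem_head.
move=> y; rewrite inE le_max => /predU1P[->|/Fr ->//].
by rewrite lexx orbT.
Qed.

(** After F is scaled up from a ball of radius r < 1, half a difference of the
    y n, of norm at least 1/2, fits. As r is taken at least 1/2, scaling back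
    leaves a norm of at least 1/4. *)
Lemma separated_room (y : nat -> V) :
  absorbs_differences V -> (forall n, rnorm (y n) <= 1) ->
  (forall n m, (n < m)%N -> 1 <= rnorm (y n - y m)) -> room 8^-1.
Proof.
move=> VA y1 ysep F F1; have [r /andP[r2 r1] Fr] := in_smaller_ball F1.
have r0 : 0 < r by apply: lt_le_trans r2; rewrite invr_gt0.
have e0 : 0 < (1 - r) / 2 by rewrite divr_gt0// subr_gt0.
have [|n [m [nm h]]] := VA y [seq ofreal r^-1 *: x | x <- F] _ y1 _ e0.
  move=> _ /mapP[x xF ->]; rewrite rnormZr ?invr_ge0 ?(ltW r0)//.
  by rewrite ler_pdivrMl// mulr1 Fr.
set d := ofreal 2^-1 *: _ in h.
have d_ge : 2^-1 <= rnorm d by rewrite rnormZr ?invr_ge0// ler_peMr ?invr_ge0// ysep.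
exists (ofreal r *: d).
  move=> x xF; have [hp hm] := h _ (map_f _ xF).
  have xE : x = ofreal r *: (ofreal r^-1 *: x).
    by rewrite scalerA -ofrealM mulfV ?gt_eqF// ofreal1 scale1r.
  have r_lt : r * (1 + (1 - r) / 2) < 1.
    have : 0 < (1 - r) * (1 - r / 2) by rewrite mulr_gt0//; lra.
    lra.
  by split; rewrite {1}xE -?scalerDr -?scalerBr rnormZr ?(ltW r0)//;
    apply: le_lt_trans r_lt; rewrite ler_pM2l.
rewrite rnormZr ?(ltW r0)//; have : 2^-1 * 2^-1 <= r * rnorm d.
  by rewrite ler_pM ?invr_ge0.
lra.
Qed.

Definition signs (s : nat -> K) : Prop := forall i, s i \in [:: 0; 1; -1].

Definition combination z (s : nat -> K) n : V := \sum_(0 <= i < n) s i *: z i.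

Definition adjoin (x : V) F : seq V := F ++ map (+%R^~ x) F ++ map (+%R^~ (- x)) F.

(** The supremum a of the available room is almost attained by a finite set F0.
    Choosing greedily vectors z j of norm almost a that fit F0 and all shifts
    of F0 by sign combinations of the earlier z i, every sign combination of
    the z j fits F0 as well, whence its norm hardly exceeds a. *)
Lemma room_c0_sequence (e : R) : room 8^-1 -> 0 < e < 1 ->
  exists z, (forall j, 1 - e < rnorm (z j)) /\
    forall s n, signs s -> rnorm (combination z s n) <= 1.
Proof.
move=> room8 /andP[e0 e1].
have room_le1 c : room c -> c <= 1.
  move=> /(_ [:: 0])[x|z /(_ 0 (mem_head _ _))].
    by rewrite inE => /eqP ->; rewrite rnorm0.
  by rewrite add0r => -[/ltW z1 _] /ltW cz; exact: le_trans cz z1.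
have room_sup : has_sup room by split; [exists 8^-1|exists 1 => c /room_le1].
pose a := sup room; have a8 : 8^-1 <= a by exact: (sup_upper_bound room_sup).
have a0 : 0 < a by apply: lt_le_trans a8; rewrite invr_gt0.
pose d := e / 2; have d0 : 0 < d by rewrite divr_gt0.
have [c room_c ca] := sup_adherent (mulr_gt0 a0 d0) room_sup.
have [F0 F0ball F0max] : exists2 F0, in_open_ball F0 &
    forall z : V, fits F0 z -> rnorm z <= a * (1 + d).
  apply: contrapT => no; have : room (a * (1 + d)).
    move=> F F1; apply: contrapT => noz; apply: no; exists F => // z Fz.
    by rewrite leNgt; apply/negP => az; apply: noz; exists z.
  move=> /(sup_upper_bound room_sup); rewrite -/a ger_pMr//.
  by rewrite gerDl leNgt d0.
pose shifts l := foldr adjoin F0 l.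
have [z [L [L0 LS zP]]] := @greedy_sequence V
  (fun l x => in_open_ball (shifts l) -> fits (shifts l) x /\ c < rnorm x)
  (fun l => match pselect (in_open_ball (shifts l)) with
    | left lb => let: ex_intro2 x fx cx := room_c _ lb in
        ex_intro _ x (fun _ => conj fx cx)
    | right nlb => ex_intro _ 0 (fun lb => False_ind _ (nlb lb))
    end).
have Lball n : in_open_ball (shifts (L n)).
  elim: n => [|n IH]; first by rewrite L0.
  have [zfit _] := zP n IH; rewrite LS /= => x; rewrite !mem_cat.
  by case/or3P => [/IH//|/mapP[y yL ->]|/mapP[y yL ->]]; have [] := zfit y yL.
have zc n : c < rnorm (z n) by have [] := zP n (Lball n).
have shiftP s n x : signs s -> x \in F0 -> x + combination z s n \in shifts (L n).
  move=> ss xF0; elim: n => [|n IH].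
    by rewrite L0 /combination big_geq// addr0.
  rewrite LS /combination big_nat_recr//= addrA -/(combination z s n) !mem_cat.
  have := ss n; rewrite !inE => /or3P[]/eqP ->.
  - by rewrite scale0r addr0 IH.
  - by rewrite scale1r (map_f (+%R^~ (z n)) IH) orbT.
  - by rewrite scaleN1r (map_f (+%R^~ (- z n)) IH) !orbT.
have comb_le s n : signs s -> rnorm (combination z s n) <= a * (1 + d).
  move=> ss; apply: F0max => x xF0; split.
    by apply: (Lball n); exact: shiftP.
  apply: (Lball n); have -> : - combination z s n = combination z (fun i => - s i) n.
    by rewrite /combination -sumrN; apply: eq_bigr => i _; rewrite scaleNr.
  apply: shiftP => // i; have := ss i; rewrite !inE.
  by case/or3P => /eqP ->; rewrite ?oppr0 ?opprK ?eqxx ?orbT.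
have ad0 : 0 < a * (1 + d) by rewrite mulr_gt0// addr_gt0.
exists (fun j => ofreal (a * (1 + d))^-1 *: z j); split=> [j|s n ss].
  rewrite rnormZr ?invr_ge0 ?(ltW ad0)// ltr_pdivlMl//.
  apply: le_lt_trans (lt_trans ca (zc j)).
  rewrite -/a -[X in _ <= X - _]mulr1 -mulrBr -mulrA ler_pM2l//.
  rewrite /d; have := mulr_gt0 e0 e0; lra.
rewrite /combination; under eq_bigr do rewrite scalerA mulrC -scalerA.
rewrite -scaler_sumr rnormZr ?invr_ge0 ?(ltW ad0)// ler_pdivrMl// mulr1.
exact: comb_le.
Qed.

Section C0Sequence.
Context {z : nat -> V} {e : R}.
Hypothesis z_ge : forall j, 1 - e < rnorm (z j).
Hypothesis z_le : forall s n, signs s -> rnorm (combination z s n) <= 1.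

Lemma combinationD s t n :
  combination z s n + combination z t n = combination z (fun i => s i + t i) n.
Proof. by rewrite -big_split; apply: eq_bigr => i _; rewrite scalerDl. Qed.

Lemma combinationN s n : - combination z s n = combination z (fun i => - s i) n.
Proof. by rewrite -sumrN; apply: eq_bigr => i _; rewrite scaleNr. Qed.

Lemma combination_single j n : (j < n)%N ->
  z j = combination z (fun i => (i == j)%:R) n.
Proof.
move=> jn; rewrite /combination (@bigD1_seq _ _ _ _ _ j) ?mem_index_iota ?iota_uniq//=.
rewrite eqxx scale1r big1 ?addr0// => i /negbTE ->.
by rewrite scale0r.
Qed.

Lemma combination_widen s m n : (m <= n)%N ->
  combination z s m = combination z (fun i => if (i < m)%N then s i else 0) n.
Proof.
move=> mn; rewrite /combination [RHS](@big_cat_nat _ _ _ m)//=.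
rewrite [X in _ = _ + X]big_nat_cond [X in _ = _ + X]big1 ?addr0.
  by apply: eq_big_nat => i /andP[_ ->].
by move=> i /andP[/andP[mi _] _]; rewrite ltnNge mi scale0r.
Qed.

(** In the space c0 the vectors e_0 + ... + e_(n-1) - e_n of the unit sphere have
    mutual distance two, the difference of two of them having a coordinate 2.
    Only upper bounds for sign combinations are at hand, but they suffice: if y
    is the difference and n the coordinate, 3 *: z n - y is a sign combination,
    so 3 * rnorm (z n) is at most rnorm y + 1. *)
Lemma c0_two_separated : exists y : nat -> V,
  (forall n, rnorm (y n) <= 1) /\
  (forall n m, (n < m)%N -> 2 - 3 * e <= rnorm (y n - y m)).
Proof.
pose s n i : K := if (i < n)%N then 1 else if i == n then -1 else 0.
have ss n : signs (s n).
  by move=> i; rewrite /s; case: ifP => _; [|case: ifP => _]; rewrite !inE eqxx ?orbT.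
exists (fun n => combination z (s n) n.+1); split=> [n|n m nm]; first exact: z_le.
have nm1 : (n < m.+1)%N by rewrite ltnS ltnW.
rewrite rnormB; set y : V := _ - _.
pose t i : K := if (i < n)%N then 0 else
  if i == n then 1 else if (i < m)%N then -1 else if i == m then 1 else 0.
have tE : 3%:R *: z n - y = combination z t m.+1.
  rewrite /y (combination_widen (s n) nm1) (combination_single nm1).
  rewrite scaler_sumr !combinationN combinationD combinationN.
  under eq_bigr do rewrite scalerA.
  rewrite -/(combination z (fun i => 3%:R * (i == n)%:R) m.+1) combinationD.
  apply: eq_bigr => i _; congr (_ *: _); rewrite /s /t ltnS.
  have [im|im|->] := ltngtP i n.
  - rewrite (ltn_trans im nm) /=; ring.
  - case: ltngtP => _ /=; ring.
  - rewrite nm /=; ring.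
have := ler_rnormD y (3%:R *: z n - y); rewrite addrC subrK tE.
have st : signs t.
  by move=> i; rewrite /t; do ![case: ifP => _]; rewrite !inE eqxx ?orbT.
have := z_le m.+1 st; have := z_ge n.
have -> : (3%:R : K) = ofreal 3%:R by rewrite -addn1 -addn1 !natrD !ofrealD !ofreal1.
by rewrite rnormZr//; lra.
Qed.

End C0Sequence.
End AlmostIsometricC0.

(** * Slices and reflexivity *)

Section Conclusions.
Context {R : realType} {k : scalar_kind}.
Local Notation K := (scalarField R k).
Context {V : normedModType K}.
Hypothesis V_absorbs : absorbs_differences V.
Hypothesis V_room : room (V := V) 8^-1.

(** A point x where f is almost 1 is moved in the directions z and -z, z half
    the difference of two members of a 2-separated sequence: both ends stay
    almost in the ball, so f must be almost 1 at both, and their distance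
    is almost 2. *)
Lemma slice_far_points (f : dual V) (delta e : R) :
  rnorm f = 1 -> 0 < e < 1 -> 4 * e <= delta ->
  exists p q, [/\ slice f delta p, slice f delta q & 2 - 6 * e <= rnorm (p - q)].
Proof.
move=> f1 /andP[e0 e1] e_delta.
have [|z [z_ge z_le]] := room_c0_sequence V_room (e := e); first by rewrite e0.
have [y [y1 ysep]] := c0_two_separated z_ge z_le.
have [x x1 fx] := dual_norm_adherent f e0.
have [|n [m [nm h]]] := V_absorbs y1 (F := [:: x]) _ e0.
  by move=> _ /[!inE] /eqP ->.
have [] := h x (mem_head _ _); set d := ofreal 2^-1 *: _ => hp hm.
have d_ge : 2 - 3 * e <= 2 * rnorm d.
  by rewrite rnormZr ?invr_ge0// mulrA mulfV ?mul1r ?ysep.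
have fp := re_dual_le f (x + d); have fm := re_dual_le f (x - d).
move: fp fm; rewrite f1 !mul1r linearB linearD reB reD => fp fm.
have e10 : 0 < 1 + e by rewrite addr_gt0.
have inS w : rnorm w <= 1 + e -> 1 - 3 * e < re (f w) ->
    slice f delta (ofreal (1 + e)^-1 *: w).
  move=> w1 fw; split; rewrite /unit_ball/=.
    by rewrite rnormZr ?invr_ge0 ?(ltW e10)// ler_pdivrMl// mulr1.
  rewrite linearZ /= re_ofrealM ltr_pdivlMl//; apply: le_lt_trans fw.
  have : (1 + e) * (1 - delta) <= (1 + e) * (1 - 4 * e) by rewrite ler_pM2l//; lra.
  have := mulr_gt0 e0 e0; lra.
exists (ofreal (1 + e)^-1 *: (x + d)), (ofreal (1 + e)^-1 *: (x - d)); split.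
- by apply: inS => //; rewrite linearD reD; lra.
- by apply: inS => //; rewrite linearB reB; lra.
- rewrite -scalerBr opprD opprK addrACA subrr add0r rnormZr ?invr_ge0 ?(ltW e10)//.
  have -> : rnorm (d + d) = 2 * rnorm d.
    have -> : d + d = ofreal 2 *: d.
      by rewrite -[2]/(1 + 1) ofrealD ofreal1 scalerDl scale1r.
    by rewrite rnormZr.
  rewrite ler_pdivlMl//; apply: le_trans d_ge.
  have := mulr_gt0 e0 e0; lra.
Qed.

Lemma room_LD2P : LD2P V.
Proof.
move=> f delta f1 delta0; apply/eqP; rewrite eq_le; apply/andP; split.
  apply: ge_ereal_sup => _ [[p q] [[/= p1 _] [/= q1 _]] <-]; rewrite lee_fin.
  by rewrite (le_trans (ler_rnormB _ _))// -[2]/(1 + 1) lerD.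
apply/lee_addgt0Pr => eps eps0.
pose e := Num.min (2^-1) (Num.min (delta / 4) (eps / 6)).
have e0 : 0 < e by rewrite !lt_min invr_gt0 ltr0n !divr_gt0.
have e2 : e <= 2^-1 by rewrite ge_min lexx.
have ed : e <= delta / 4 by rewrite !ge_min lexx !orbT.
have ee : e <= eps / 6 by rewrite !ge_min lexx !orbT.
have [||p [q [Sp Sq pq]]] := slice_far_points (delta := delta) (e := e) f1.
- by rewrite e0/=; lra.
- lra.
apply: (@le_trans _ _ ((rnorm (p - q))%:E + eps%:E)%E).
  by rewrite -EFinD lee_fin; lra.
by apply: leeD => //; apply: ereal_sup_ubound; exists (p, q).
Qed.

(** The partial sums s n of an almost isometric copy of the unit vectors of
    c0 and norming functionals f j of its members violate the equality of
    iterated cluster values that weak compactness would imply: re (f j (s n))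
    is almost 0 if n <= j and almost 1 if j < n. A cluster point of the s n
    in the bidual is thus almost 1 at each f j, but almost 0 at a cluster
    point of the f j, which cannot happen if it is evaluation at a vector. *)
Lemma room_not_reflexive : ~ reflexive_space V.
Proof.
move=> refl; pose e : R := 10^-1.
have [|z [z_ge z_le]] := room_c0_sequence V_room (e := e).
  by rewrite invr_gt0 ltr0n invf_lt1 ?ltr0n// ltr1n.
have [f fP] : exists f : nat -> dual V,
    forall j, rnorm (f j) <= 1 /\ 1 - e < re (f j (z j)).
  have h j : {g : dual V | rnorm g <= 1 /\ 1 - e < re (g (z j))}.
    apply: cid; have [g g1 gz] := norming_functional (z j).
    by exists g; rewrite gz.
  by exists (fun j => sval (h j)) => j; exact: svalP (h j).
pose s n := combination z (fun=> 1) n.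
have s_sign : signs (fun=> 1 : K) by move=> i; rewrite !inE eqxx orbT.
have f_le j x : rnorm x <= 1 -> re (f j x) <= 1.
  move=> x1; rewrite (le_trans (re_dual_le _ _))//.
  by rewrite mulr_ile1// ?rnorm_ge0//; case: (fP j).
have [fs_lo fs_hi] : (forall n j, (n <= j)%N -> re (f j (s n)) <= e) /\
    (forall n j, (j < n)%N -> 1 - 2 * e <= re (f j (s n))).
  split=> n j nj.
    have [_ fz] := fP j.
    have : re (f j (s n + z j)) <= 1.
      apply: f_le; have nj1 : (n <= j.+1)%N by rewrite ltnW.
      rewrite /s (combination_widen (z := z) _ nj1).
      rewrite (combination_single (z := z) (ltnSn j)).
      rewrite combinationD; apply: z_le => i; rewrite !inE.
      case: (i =P j) => [->|_] /=; first by rewrite ltnNge nj /= add0r eqxx orbT.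
      by rewrite addr0; case: ifP => _; rewrite eqxx ?orbT.
    by rewrite linearD reD; lra.
  have [_ fz] := fP j.
  (* This vector is s n with the signs of all terms but z j reversed. *)
  have : re (f j (2%:R *: z j - s n)) <= 1.
    apply: f_le; rewrite /s combinationN (combination_single (z := z) nj) scaler_sumr.
    under eq_bigr do rewrite scalerA.
    rewrite -/(combination z (fun i => 2%:R * (i == j)%:R) n) combinationD.
    apply: z_le => i; rewrite !inE; case: (i == j) => /=.
      by rewrite mulr1 -[2%:R]/(1 + 1) addrK eqxx orbT.
    by rewrite mulr0 add0r eqxx !orbT.
  rewrite linearB scaler_nat -[z j *+ 2]/(z j + z j) linearD reB reD.
  lra.
have s_linear n : real_linear (fun g : dual V => re (g (s n))).
  split=> [g h|t g]; first by rewrite blinD reD.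
  by rewrite blinZ -re_ofrealM.
have s_le n (g : dual V) : re (g (s n)) <= rnorm g.
  by rewrite (le_trans (re_dual_le g (s n)))// ler_piMr ?rnorm_ge0// z_le.
have [phi phiP] := cluster_functional s_linear s_le.
have [w wP] := refl phi.
have f_norm_le j x : re (f j x) <= rnorm x.
  by rewrite (le_trans (re_dual_le (f j) x))// ler_piMl ?rnorm_ge0//; case: (fP j).
have [g gP] := cluster_functional (fun j => real_linear_re (f j)) f_norm_le.
have gw_hi : re (g w) <= e.
  rewrite -wP; apply: phiP; exists 0%N => n _.
  by apply: gP; exists n => j; exact: fs_lo.
have fw j : 1 - 2 * e <= re (f j w).
  rewrite -lerN2 -reN -wP; have -> : - phi (f j) = phi (- f j) by rewrite linearN.
  apply: phiP; exists j.+1 => n jn.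
  by rewrite blinN reN lerN2 fs_hi.
have : re (g (- w)) <= - (1 - 2 * e).
  by apply: gP; exists 0%N => j _; rewrite linearN reN lerN2; exact: fw.
rewrite linearN reN lerN2.
have e0 : 0 < e by rewrite invr_gt0.
have : 10 * e = 1 by rewrite /e mulfV.
lra.
Qed.

End Conclusions.

Theorem corollary2p7 (R : realType) (k : scalar_kind)
    (Y : completeNormedModType (scalarField R k))
    (Y_infinite : ~ finite_dimensional Y)
    (KY_M_ideal : M_ideal (compact_operators (ell1 R k) Y))
    (Z : closedSubspace Y) (W : closedSubspace (quotientType Z))
    (W_infinite : ~ finite_dimensional (subspaceType W)) :
  LD2P (subspaceType W) /\ ~ reflexive_space (subspaceType W).
Proof.
have WA : absorbs_differences (subspaceType W).
  apply/subspace_absorbs_differences/quotient_absorbs_differences.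
  exact: M_ideal_absorbs_differences.
have [y [y1 ysep]] := separated_sequence W_infinite.
have Wroom : room (V := subspaceType W) 8^-1.
  by apply: separated_room WA _ ysep => n; rewrite y1.
by split; [exact: room_LD2P|exact: room_not_reflexive].
Qed.
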